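(* Let $\mathbf{G}=(V,G)$ be a network with $n$ nodes and diameter $\Delta$, in which each node has a port for each incident edge. Every $FP_{loc}$ formula $\mu(\varphi^{(k)}(T)(x,\bar y))$ can be evaluated on $\mathbf{G}$ by a distributed algorithm, with each node $a$ storing the tuples $(a,\bar b)$ of the fixpoint, with complexity: IN-TIME/ROUND $=O(1)$, DIST-TIME $=O(n)$, MSG-SIZE $=O(1)$, $\#$MSG/NODE $=O(1)$.
   Context: Networks are finite, connected, undirected graphs $\mathbf{G}=(V,G)$ with degree bounded by a constant $D$, $n=|V|$ and diameter $\Delta$. The model is synchronous message passing: each node knows its identifier, its neighbours, $n$ and $\Delta$, and can send messages through the port of each incident edge. A query is posed by a requesting node. Complexity measures: IN-TIME/ROUND is the maximal in-node computation time in one round; DIST-TIME is the maximal number of rounds until termination; MSG-SIZE is the maximal number of bits of a message; $\#$MSG/NODE is the maximal number of messages sent by a node. Bounds are in terms of $n$ and $\Delta$, with the formula, $k$ and $D$ fixed. Local fragment: $\mathcal{N}^k(x)=\{y: dist(x,y)\le k\}$. For a first-order formula $\varphi(x,\bar y)$, the formula $\varphi^{(k)}(x,\bar y)$ is obtained by relativizing every quantifier to $\mathcal{N}^k(x)$ and adding $y\in\mathcal{N}^k(x)$ for every free variable $y$ in $\bar y$. $FP_{loc}$ is the set of fixpoint formulas $\mu(\varphi^{(k)}(T)(x,\bar y))$, where $\bar y=y_1\dots y_\ell$, $\varphi^{(k)}(T)$ is such a relativized first-order formula over $\{G,T\}$, and $T$ has arity $\ell+1$. The fixpoint is the inflationary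 one: $I_0=\emptyset$, $I_{i+1}=\varphi^{(k)}(I_i)\cup I_i$. *)

(* Defs.v *)
From mathcomp Require Import all_boot.

Set Implicit Arguments.
Unset Strict Implicit.
Unset Printing Implicit Defensive.

(** * Networks *)

(** Port [i] of a node [u] leads to the [i]-th entry of [ports u]. *)
Record network := Network {
  node :> finType;
  edge : rel node;
  edge_sym : symmetric edge;
  edge_irr : irreflexive edge;
  edge_conn : forall u v, connect edge u v;
  ports : node -> seq node;
  ports_uniq : forall u, uniq (ports u);
  mem_ports : forall u v, (v \in ports u) = edge u v;
  ident : node -> nat;
  ident_inj : injective ident
}.

Definition degree (N : network) (u : N) : nat := #|[pred v | edge u v]|.

(** Length of a shortest path; the value [#|V|] stands for "unreachable",
    which does not occur in a connected graph. *)
Definition dist (V : finType) (e : rel V) (u v : V) : nat :=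
  find (fun d => [exists p : d.-tuple V, path e u p && (last u p == v)])
       (iota 0 #|V|).

Definition diameter (N : network) : nat :=
  \max_(u : N) \max_(v : N) dist (@edge N) u v.

(** * First-order formulas over [{G, T}] *)

(** [fo r n]: formulas with free variables among [0, ..., n-1], where [T] has
    arity [r]. A quantifier in scope [n] binds the variable [n], so the
    variables already in scope keep their number under quantifiers. *)
Inductive fo (r : nat) : nat -> Type :=
| Equ n of 'I_n & 'I_n : fo r n
| Adj n of 'I_n & 'I_n : fo r n
| Rel n of r.-tuple 'I_n : fo r n
| Neg n of fo r n : fo r n
| And n of fo r n & fo r n : fo r n
| Or n of fo r n & fo r n : fo r n
| Exi n of fo r n.+1 : fo r n
| All n of fo r n.+1 : fo r n.

Arguments Equ {r n}.
Arguments Adj {r n}.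
Arguments Rel {r n}.

Fixpoint sat (V : finType) (e : rel V) r (T : {set r.-tuple V}) n (f : fo r n) :
  n.-tuple V -> bool :=
  match f in fo _ n return n.-tuple V -> bool with
  | Equ _ i j => fun s => tnth s i == tnth s j
  | Adj _ i j => fun s => e (tnth s i) (tnth s j)
  | Rel _ t => fun s => [tuple of map (tnth s) t] \in T
  | Neg _ f => fun s => ~~ sat e T f s
  | And _ f g => fun s => sat e T f s && sat e T g s
  | Or _ f g => fun s => sat e T f s || sat e T g s
  | Exi _ f => fun s => [exists v, sat e T f [tuple of rcons s v]]
  | All _ f => fun s => [forall v, sat e T f [tuple of rcons s v]]
  end.

Definition wk n (i : 'I_n) : 'I_n.+1 := widen_ord (leqnSn n) i.

(** The formula [j \in N^k(i)]; see [sat_near]. *)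
Fixpoint near r (k n : nat) : 'I_n -> 'I_n -> fo r n :=
  match k with
  | 0 => fun i j => Equ i j
  | k'.+1 => fun i j =>
      Exi (And (Or (Equ (wk i) ord_max) (Adj (wk i) ord_max))
               (near r k' ord_max (wk j)))
  end.

Lemma dist_le (V : finType) (e : rel V) (u v : V) k :
  connect e u v ->
  dist e u v <= k <-> exists p, [/\ size p <= k, path e u p & last u p = v].
Proof.
move=> /connectP[q eq_q lastq]; rewrite /dist.
set P := fun d => _; set s := iota 0 _.
have PP d p : size p = d -> path e u p -> last u p = v -> P d.
  move=> /eqP sp pp lp; apply/existsP; exists (Tuple sp) => /=.
  by rewrite pp lp eqxx.
have [p0 [pp0 up0 lp0]] : exists p, [/\ path e u p, uniq (u :: p) & last u p = v].
  by case/shortenP: eq_q lastq => p pp up _ ->; exists p.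
have sz0 : size p0 < #|V| by have /card_uniqP/= := up0 => <-; exact: max_card.
split=> [lek|[p [szp pp lp]]].
  have hasP : has P s.
    by apply/hasP; exists (size p0); [rewrite mem_iota | apply: (PP _ p0)].
  have lt_find : find P s < #|V| by move: hasP; rewrite has_find size_iota.
  have := nth_find 0 hasP; rewrite nth_iota // add0n.
  case/existsP=> p /andP[pp /eqP lp]; exists p; split=> //.
  by rewrite size_tuple.
rewrite leqNgt; apply/negP => ltk.
case: (ltnP (size p) #|V|) => [ltV|geV].
  have /(before_find 0) : size p < find P s by exact: leq_ltn_trans szp ltk.
  by rewrite nth_iota // add0n (PP _ p).
have : find P s <= size s by exact: find_size.
by rewrite size_iota leqNgt (leq_ltn_trans _ ltk) // (leq_trans geV).
Qed.

Lemma sat_near (V : finType) (e : rel V) r (T : {set r.-tuple V}) k n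
    (i j : 'I_n) (s : n.-tuple V) :
  (forall u v, connect e u v) ->
  sat e T (near r k i j) s = (dist e (tnth s i) (tnth s j) <= k).
Proof.
move=> conn; apply/idP/idP => [|/(dist_le _ (conn _ _))].
  move=> H; apply/(dist_le _ (conn _ _)); move: H.
  elim: k n i j s => [|k IH] n i j s /=.
    by move=> /eqP ->; exists [::].
  have wkE (a : 'I_n) w : tnth [tuple of rcons s w] (wk a) = tnth s a.
    by rewrite !(tnth_nth w) /= nth_rcons size_tuple ltn_ord.
  have mxE w : tnth [tuple of rcons s w] ord_max = w.
    by rewrite !(tnth_nth w) /= nth_rcons size_tuple ltnn eqxx.
  case/existsP=> w /andP[]; rewrite !wkE mxE => hw /IH[p []].
  rewrite wkE mxE => szp pp lp; case/orP: hw => [/eqP ->|ew].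
    by exists p; rewrite (leq_trans szp).
  by exists (w :: p); rewrite /= ew.
elim: k n i j s => [|k IH] n i j s /= [p [szp pp lp]].
  by case: p szp pp lp => //= _ _ ->.
have wkE (a : 'I_n) w : tnth [tuple of rcons s w] (wk a) = tnth s a.
  by rewrite !(tnth_nth w) /= nth_rcons size_tuple ltn_ord.
have mxE w : tnth [tuple of rcons s w] ord_max = w.
  by rewrite !(tnth_nth w) /= nth_rcons size_tuple ltnn eqxx.
case: p szp pp lp => [|w p] /= szp pp lp.
  apply/existsP; exists (tnth s i); rewrite !wkE mxE eqxx /=.
  by apply: IH; exists [::]; rewrite wkE mxE.
case/andP: pp => ew pp; apply/existsP; exists w; rewrite !wkE mxE ew orbT /=.
by apply: IH; exists p; rewrite wkE mxE.
Qed.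

Fixpoint relativize r (k : nat) n (f : fo r n) : 'I_n -> fo r n :=
  match f in fo _ n return 'I_n -> fo r n with
  | Equ _ i j => fun=> Equ i j
  | Adj _ i j => fun=> Adj i j
  | Rel _ t => fun=> Rel t
  | Neg _ f => fun x => Neg (relativize k f x)
  | And _ f g => fun x => And (relativize k f x) (relativize k g x)
  | Or _ f g => fun x => Or (relativize k f x) (relativize k g x)
  | Exi _ f => fun x =>
      Exi (And (near r k (wk x) ord_max) (relativize k f (wk x)))
  | All _ f => fun x =>
      All (Or (Neg (near r k (wk x) ord_max)) (relativize k f (wk x)))
  end.

(** [phi^(k)(x, y_1, ..., y_l)], where [x] is variable [0] and [y_i] is
    variable [i]. *)
Definition localize r (k l : nat) (f : fo r l.+1) : fo r l.+1 :=
  foldr (fun j g => And (near r k ord0 (lift ord0 j)) g)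
        (relativize k f ord0) (enum 'I_l).

(** * Inflationary fixpoints *)

Fixpoint stage (V : finType) (e : rel V) r (f : fo r r) (i : nat) :
  {set r.-tuple V} :=
  match i with
  | 0 => set0
  | i'.+1 => [set s | sat e (stage e f i') f s] :|: stage e f i'
  end.

Definition in_mu (V : finType) (e : rel V) r (f : fo r r) (s : r.-tuple V) :
  Prop := exists i, s \in stage e f i.

(** * Node programs: multitape Turing machines *)

Definition symbol := option bool.

Record tape := Tape { leftward : seq symbol; here : symbol; rightward : seq symbol }.

Inductive head_move := Lft | Stay | Rgt.

Definition move_tape (m : head_move) (t : tape) : tape :=
  let: Tape l h r := t in
  match m with
  | Lft => Tape (behead l) (head None l) (h :: r)
  | Stay => t
  | Rgt => Tape (h :: l) (head None r) (behead r)
  end.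

Definition write (a : symbol) (t : tape) : tape :=
  Tape (leftward t) a (rightward t).

Definition load (w : seq bool) : tape :=
  let s := [seq Some b | b <- w] in Tape [::] (head None s) (behead s).

(** The non-blank symbols of the tape, from left to right. *)
Definition word (t : tape) : seq bool :=
  pmap id (rev (leftward t) ++ here t :: rightward t).

Inductive tape_name (D w : nat) :=
| Tident
| Tsize
| Tdiam
| Trequest
| Tnbr of 'I_D
| Tin of 'I_D
| Tout of 'I_D
| Tresult
| Twork of 'I_w.

Arguments Tident {D w}.
Arguments Tsize {D w}.
Arguments Tdiam {D w}.
Arguments Trequest {D w}.
Arguments Tnbr {D w}.
Arguments Tin {D w}.
Arguments Tout {D w}.
Arguments Tresult {D w}.
Arguments Twork {D w}.

(** A node computes in a round until its control state is in [pause], which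
    ends the round, or in [halt], which ends its whole computation. *)
Record machine (D : nat) := Machine {
  state : finType;
  start : state;
  pause : pred state;
  halt : pred state;
  nwork : nat;
  delta : state -> (tape_name D nwork -> symbol) ->
          state * (tape_name D nwork -> symbol * head_move)
}.

Record nconf D (M : machine D) := NConf {
  awake : bool;
  control : state M;
  tapes : tape_name D (nwork M) -> tape
}.

Definition halted D (M : machine D) (c : nconf M) : bool := halt (control c).

Definition stopped D (M : machine D) (c : nconf M) : bool :=
  pause (control c) || halt (control c).

Definition step D (M : machine D) (c : nconf M) : nconf M :=
  let: (q, act) := delta (control c) (fun x => here (tapes c x)) in
  NConf true q
    (fun x => move_tape (act x).2 (write (act x).1 (tapes c x))).

(** Little-endian binary notation, never empty. *)
Definition bits (n : nat) : seq bool :=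
  [seq odd (n %/ 2 ^ i) | i <- iota 0 (trunc_log 2 n).+1].

(** * Synchronous executions *)

(** Every node initially knows its identifier, the identifier of the neighbour
    behind each of its ports (so also which ports exist), [n], the diameter,
    and whether it is the requesting node [r]. Only [r] is awake; any other
    node starts its program when it receives its first message. *)
Definition init_conf D (M : machine D) (N : network) (r v : N) : nconf M :=
  NConf (v == r) (start M)
    (fun x => match x with
     | Tident => load (bits (ident v))
     | Tsize => load (bits #|N|)
     | Tdiam => load (bits (diameter N))
     | Trequest => load [:: v == r]
     | Tnbr i => if onth (ports v) i is Some u then load (bits (ident u))
                 else load [::]
     | _ => load [::]
     end).

(** The message a node has just sent through port [i]; the empty word means
    that no message is sent. *)
Definition message D (M : machine D) (c : nconf M) (i : nat) : seq bool :=
  if insub i is Some p then word (tapes c (Tout p)) else [::].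

Definition inbox D (M : machine D) (N : network) (C : N -> nconf M) (v : N)
    (i : nat) : seq bool :=
  if onth (ports v) i is Some u then message (C u) (index v (ports u))
  else [::].

Definition deliver D (M : machine D) (m : nat -> seq bool) (c : nconf M) :
  nconf M :=
  NConf (awake c || [exists i : 'I_D, m i != [::]]) (control c)
    (fun x => match x with
     | Tin i => load (m i)
     | Tout _ => load [::]
     | _ => tapes c x
     end).

(** [node_round m c t c']: in one round with incoming messages [m], the node
    goes from [c] to [c'] in [t] elementary steps. *)
Definition node_round D (M : machine D) (m : nat -> seq bool) (c : nconf M)
    (t : nat) (c' : nconf M) : Prop :=
  let c0 := deliver m c in
  if awake c0 && ~~ halted c then
    [/\ 0 < t, c' = iter t (@step D M) c0, stopped c' &
        forall s, 0 < s < t -> ~~ stopped (iter s (@step D M) c0)]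
  else t = 0 /\ c' = c0.

Record run D (M : machine D) (N : network) (r : N) := Run {
  rounds : nat;
  conf : nat -> N -> nconf M;
  steps : nat -> N -> nat;
  run_init : forall v, conf 0 v = init_conf M r v;
  run_round : forall i v, i < rounds ->
    node_round (inbox (conf i) v) (conf i v) (steps i v) (conf i.+1 v);
  run_halted : forall v, halted (conf rounds v);
  run_first : forall i, i < rounds -> exists v, ~~ halted (conf i v)
}.

(** Complexity measures of a terminating run. The messages sent in round [i]
    are found in [conf i.+1]. *)
Definition in_time_per_round D (M : machine D) (N : network) (r : N)
    (R : run M r) : nat :=
  \max_(i < rounds R) \max_(v : N) steps R i v.

Definition dist_time D (M : machine D) (N : network) (r : N)
    (R : run M r) : nat := rounds R.

Definition msg_size D (M : machine D) (N : network) (r : N)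
    (R : run M r) : nat :=
  \max_(i < rounds R) \max_(v : N) \max_(p < D)
    size (message (conf R i.+1 v) p).

Definition msg_per_node D (M : machine D) (N : network) (r : N)
    (R : run M r) : nat :=
  \max_(v : N) \sum_(i < rounds R)
    #|[pred p : 'I_D | message (conf R i.+1 v) p != [::]]|.

(** * Stored results *)

(** A node [a] refers to a node [b] by a sequence of port numbers leading from
    [a] to [b]: identifiers of remote nodes cannot be transmitted with [O(1)]
    messages of size [O(1)]. *)
Definition follow (N : network) (a : N) (p : seq nat) : option N :=
  foldl (fun o i => obind (fun u => onth (ports u) i) o) (Some a) p.

Definition enc_nat (n : nat) : seq bool := rcons (nseq n true) false.

Definition enc_seq T (enc : T -> seq bool) (s : seq T) : seq bool :=
  enc_nat (size s) ++ flatten [seq enc x | x <- s].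

(** The result tape of [c] lists addresses, relative to [a], of exactly the
    tuples [b] such that [P b]. *)
Definition stores D (M : machine D) (N : network) (c : nconf M) (a : N) l
    (P : l.-tuple N -> Prop) : Prop :=
  exists S : seq (seq (seq nat)),
    [/\ word (tapes c Tresult) = enc_seq (enc_seq (enc_seq enc_nat)) S,
        forall t, t \in S -> exists b : l.-tuple N,
          [seq follow a p | p <- t] = [seq Some x | x <- b] &
        forall b : l.-tuple N, P b <->
          [seq Some x | x <- b] \in [seq [seq follow a p | p <- t] | t <- S]].

(* Main.v *)
Require Import Defs.
From mathcomp Require Import all_boot.
From mathcomp Require Import zify.

(** The request is broadcast as a wave, so that neighbouring nodes start their
    local clocks at most one round apart. Sending every message as a single
    bit, in the slot of three rounds numbered by its content, then simulates a
    perfectly synchronous algorithm with messages from a finite alphabet; all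
    the local computation is done by the finite control, one step per round.
    A binary counter on the tape holding [n], whose increments have constant
    amortized cost, overflows every [Theta(n)] rounds and tells all nodes when
    to change phase and when to halt.

    Identifiers are unbounded and useless. In the first phase a token performs
    a depth-first search, and its holder floods its [K]-neighbourhood; a node
    thereby learns which of its addresses (port sequences of length at most
    [K]) lead to the same node, since these are the ones reached by the same
    flooding. In the second phase each epoch computes one stage of the
    fixpoint: [phi^(k)] is evaluated over addresses, and a node floods its
    facts only when they have changed, which happens [O(1)] times. There are at
    most [O(n)] stages, since only [O(n)] tuples are local. *)

Set Implicit Arguments.
Unset Strict Implicit.
Unset Printing Implicit Defensive.

(** * A clock counting up to multiples of [n] *)

(** In mode [up] the head carries through the ones from the lowest bit; otherwise it travels back to
    the blank left of the word. A carry that reaches the blank on the right is dropped, so the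
    counter keeps its width and wraps to zero. *)
Definition clock_act (up : bool) (a : symbol) : bool * (symbol * head_move) :=
  match up, a with
  | true, Some true => (true, (Some false, Rgt))
  | true, Some false => (false, (Some true, Lft))
  | true, None => (false, (None, Lft))
  | false, Some b => (false, (Some b, Lft))
  | false, None => (true, (None, Rgt))
  end.

Definition clock_overflow (up : bool) (a : symbol) : bool := up && (a == None).

Definition act_tape (a : symbol * head_move) (t : tape) : tape :=
  move_tape a.2 (write a.1 t).

Definition clock_step (c : bool * tape * nat) : bool * tape * nat :=
  let: (up, t, k) := c in
  ((clock_act up (here t)).1, act_tape (clock_act up (here t)).2 t,
   clock_overflow up (here t) + k).

Arguments clock_step : simpl never.

Definition clock n t := iter t clock_step (true, load (bits n), 0).

Arguments clock : simpl never.

Definition at_cells (l s : seq symbol) : tape := Tape l (head None s) (behead s).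

Definition left_of (l s : seq symbol) : tape :=
  if l is x :: l' then at_cells l' (x :: s) else at_cells [::] (None :: s).

Definition blank (s : seq symbol) := all (pred1 None) s.

Lemma clock_up_run t l s k :
  iter t clock_step (true, at_cells l (nseq t (Some true) ++ s), k) =
  (true, at_cells (nseq t (Some false) ++ l) s, k).
Proof.
elim: t l => // t IH l; rewrite iterSr /=.
rewrite -[X in iter _ _ X]/(true, at_cells (Some false :: l) (nseq t (Some true) ++ s), k).
by rewrite IH; congr (_, at_cells _ _, _); elim: (t) => //= ? ->.
Qed.

Lemma clock_back_run x l s k :
  iter (size x) clock_step (false, left_of ([seq Some b | b <- x] ++ l) s, k) =
  (false, left_of l (catrev [seq Some b | b <- x] s), k).
Proof.
elim: x s => // b x IH s; rewrite iterSr -IH /=; congr (iter _ _ _).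
by case: x {IH} => [|b' x]; [case: l|].
Qed.

Lemma clock_turn l s k : blank l ->
  exists2 l', blank l' & clock_step (false, left_of l s, k) = (true, at_cells l' s, k).
Proof.
case: l => [|[b|] l] //= bl.
  by exists [:: None] => //; case: s.
by exists (None :: l) => //; case: s.
Qed.

(** The counter is about to increment, with its head on the lowest bit. The surrounding blanks are
    arbitrary because a sweep may leave explicit blanks on either side. *)
Definition clock_at (w : seq bool) (k : nat) (c : bool * tape * nat) : Prop :=
  exists l e, [/\ blank l, blank e & c = (true, at_cells l ([seq Some b | b <- w] ++ e), k)].

Lemma clock_at_start n : clock_at (bits n) 0 (clock n 0).
Proof. by exists [::], [::]; rewrite cats0. Qed.

Lemma clock_incr t w k c : clock_at (nseq t true ++ false :: w) k c ->
  clock_at (nseq t false ++ true :: w) k (iter (2 * t + 2) clock_step c).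
Proof.
case=> l [e [bl be ->]].
have -> : 2 * t + 2 = 1 + (t + (1 + t)) by lia.
rewrite map_cat map_nseq -catA !iterD clock_up_run /=.
set s := [seq _ | _ <- _] ++ e.
have -> : clock_step (true, at_cells (nseq t (Some false) ++ l) (Some false :: s), k)
   = (false, left_of ([seq Some b | b <- nseq t false] ++ l) (Some true :: s), k).
  by rewrite map_nseq; case: t => [|t] /=; [case: l {bl} => [|x l]|].
rewrite -[t in iter t](size_nseq t false) clock_back_run.
have [l' bl' ->] := clock_turn (catrev [seq Some b | b <- nseq t false] (Some true :: s)) k bl.
exists l', e; split=> //; congr (_, at_cells _ _, _).
by rewrite catrevE map_cat /= !map_nseq rev_nseq -catA.
Qed.

Lemma clock_wrap m k c : clock_at (nseq m true) k c ->
  clock_at (nseq m false) k.+1 (iter (2 * m + 2) clock_step c).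
Proof.
case=> l [e [bl be ->]].
have -> : 2 * m + 2 = 1 + (m + (1 + m)) by lia.
rewrite map_nseq !iterD clock_up_run /=.
have [e' be' ->] : exists2 e', blank e' &
  clock_step (true, at_cells (nseq m (Some false) ++ l) e, k)
   = (false, left_of ([seq Some b | b <- nseq m false] ++ l) e', k.+1).
  exists (None :: behead e); first by case: (e) be => //= x ? /andP[].
  rewrite map_nseq; case: e be => [|[b|] e] //= _;
  by case: m => [|m] /=; [case: l {bl} => [|x l]|].
rewrite -[m in iter m](size_nseq m false) clock_back_run.
have [l' bl' ->] := clock_turn (catrev [seq Some b | b <- nseq m false] e') k.+1 bl.
exists l', e'; split=> //; congr (_, at_cells _ _, _).
by rewrite catrevE !map_nseq rev_nseq.
Qed.

(** * Period of the counter *)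

Fixpoint bin_value (w : seq bool) : nat :=
  if w is b :: w' then b + 2 * bin_value w' else 0.

Lemma bin_value_ones t w :
  bin_value (nseq t true ++ w) = 2 ^ t - 1 + 2 ^ t * bin_value w.
Proof. by elim: t => [|t IH] /=; rewrite ?IH ?expnS; lia. Qed.

Lemma bin_value_zeros t w : bin_value (nseq t false ++ w) = 2 ^ t * bin_value w.
Proof. by elim: t => [|t IH] /=; rewrite ?IH ?expnS; lia. Qed.

Lemma bin_value_lt w : bin_value w < 2 ^ size w.
Proof. by elim: w => [|[] w IH] //=; rewrite expnS; lia. Qed.

Lemma first_zero (w : seq bool) :
  w = nseq (size w) true \/ exists t w', w = nseq t true ++ false :: w'.
Proof.
elim: w => [|[] w IH]; [by left| |by right; exists 0, w].
case: IH => [{1}->|[t [w' ->]]]; first by left.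
by right; exists t.+1, w'.
Qed.

(* Potential: an increment passing [t] ones takes [2t + 2] steps and removes [t] ones,
   so that the number of steps plus twice the number of ones grows by exactly [4]. *)
Lemma clock_period w k c : clock_at w k c ->
  clock_at (nseq (size w) false) k.+1
    (iter (4 * (2 ^ size w - 1 - bin_value w) + 2 * count id w + 2) clock_step c).
Proof.
move: {2}(2 ^ size w - _) (erefl (2 ^ size w - bin_value w)) => d.
elim: d w c => [|d IH] w c dE cw; first by have := bin_value_lt w; lia.
have [wE|[t [w' wE]]] := first_zero w.
  have vE : bin_value w = 2 ^ size w - 1 
    by rewrite {1}wE -[nseq _ _]cats0 bin_value_ones /= muln0 addn0.
  have cE : count id w = size w by rewrite wE count_nseq size_nseq /=; lia.
  rewrite vE cE subnn muln0 add0n; apply: clock_wrap; by rewrite -wE.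
set w1 := nseq t false ++ true :: w'.
have sE : size w1 = size w by rewrite wE !size_cat !size_nseq.
have p0 : 0 < 2 ^ t by rewrite expn_gt0.
have vE : bin_value w1 = (bin_value w).+1.
  rewrite wE bin_value_ones bin_value_zeros /=; nia.
have cE : count id w + 1 = count id w1 + t.
  rewrite wE !count_cat !count_nseq /=; lia.
rewrite wE in cw.
have := IH w1 _ _ (clock_incr cw); rewrite sE vE -iterD => /(_ _).
have lt1 := bin_value_lt w1; rewrite sE vE in lt1.
set X := iter _ _ c; move=> H.
set Y := iter _ _ c.
suff -> : Y = X by apply: H; lia.
rewrite /X /Y; congr (iter _ _ _); lia.
Qed.

Definition overflows n t : nat := (clock n t).2.

Lemma overflows_mono n t t' : t <= t' -> overflows n t <= overflows n t'.
Proof.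
move=> /subnK <-; elim: (t' - t) => // d IH.
apply: leq_trans IH _; rewrite /overflows /clock addSn iterS.
by case: (iter _ _ _) => [[up tp] k] /=; rewrite leq_addl.
Qed.

(** The width [m] satisfies [n < 2 ^ m <= 2 * n]. The count towards the first overflow starts at
    [n]; every later one starts at zero and takes [P = 4 * (2 ^ m - 1) + 2] steps. *)
Lemma overflows_period n : 0 < n -> exists P T, [/\ n <= P <= 8 * n, T <= 12 * n &
  forall j, overflows n (T + j * P) = j.+1].
Proof.
move=> n0; set m := (trunc_log 2 n).+1.
have sb : size (bits n) = m by rewrite /bits size_map size_iota.
have n2m : n < 2 ^ m by apply: trunc_log_ltn.
have m2n : 2 ^ m <= 2 * n by rewrite expnS leq_mul2l trunc_logP.
have := clock_period (clock_at_start n).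
set T := _ + 2; rewrite sb => c1.
exists (4 * (2 ^ m - 1) + 2), T; split; first lia.
  have : count id (bits n) <= m by rewrite -sb count_size.
  have : m <= 2 ^ m by rewrite ltnW // ltn_expl.
  rewrite /T sb; lia.
move=> j; suff: clock_at (nseq m false) j.+1 (clock n (T + j * (4 * (2 ^ m - 1) + 2))).
  by rewrite /overflows; case=> l [e [_ _ ->]].
elim: j => [|j IH]; first by rewrite mul0n addn0 /clock.
have := clock_period IH; rewrite size_nseq /clock -iterD.
have -> : bin_value (nseq m false) = 0 by rewrite -[nseq _ _]cats0 bin_value_zeros muln0.
rewrite count_nseq /=; congr (clock_at _ _ (iter _ _ _)); lia.
Qed.

Lemma overflows_threshold n C : 0 < n -> exists t0, forall t, (C <= overflows n t) = (t0 <= t).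
Proof.
move=> /overflows_period[P [T [_ _ ov]]].
have ex : exists t, C <= overflows n t by exists (T + C * P); rewrite ov.
exists (ex_minn ex); case: ex_minnP => t0 t0C t0min t.
apply/idP/idP; first exact: t0min.
by move=> /(overflows_mono n); apply: leq_trans.
Qed.

(** At time [T + j * P] the count is [j + 1]. Hence [t1] lies in the period after [T + c * P] and
    [t2] in the one after [T + (2 * c + 1) * P], so that more than [c * P] steps separate them. *)
Lemma clock_phases c n : 0 < n -> exists t1 t2,
  [/\ forall t, (c.+2 <= overflows n t) = (t1 <= t),
      forall t, (2 * c + 3 <= overflows n t) = (t2 <= t),
      c * n <= t1, t1 + c * n <= t2 & t2 <= (20 * c + 100) * n].
Proof.
move=> n0; have [P [T [/andP[nP Pn] Tn ov]]] := overflows_period n0.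
have [t1 t1P] := overflows_threshold c.+2 n0.
have [t2 t2P] := overflows_threshold (2 * c + 3) n0.
have h1 := t1P (T + c * P); rewrite ov ltnn in h1.
have h2 := t1P (T + c.+1 * P); rewrite ov leqnn in h2.
have h3 := t2P (T + (2 * c + 1) * P); rewrite ov in h3.
have h4 := t2P (T + (2 * c + 2) * P); rewrite ov in h4.
exists t1, t2; split=> //; nia.
Qed.

(** * Distances from the requesting node *)

Section Distance.
Variables (N : network) (r : N).
Local Notation d := (dist (@edge N) r).

Lemma dist_root : d r = 0.
Proof. by apply/eqP; rewrite -leqn0; apply/dist_le; [exact: edge_conn|exists [::]]. Qed.

Lemma dist_edge u v : edge u v -> d v <= (d u).+1.
Proof.
move=> uv; apply/dist_le; first exact: edge_conn.
have /dist_le[|p [sp pp lp]] := leqnn (d u); first exact: edge_conn.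
by exists (rcons p v); rewrite size_rcons rcons_path last_rcons pp lp.
Qed.

Lemma dist_pred v : v != r -> exists2 u, edge u v & (d u).+1 = d v.
Proof.
move=> vr; have /dist_le[|p [sp pp lp]] := leqnn (d v); first exact: edge_conn.
case/lastP: p sp pp lp => [|p w]; first by move=> _ _ /= e; rewrite e eqxx in vr.
rewrite size_rcons rcons_path last_rcons => sp /andP[pp e] wv; subst w.
exists (last r p) => //; apply/eqP; rewrite eqn_leq dist_edge // andbT.
apply: leq_ltn_trans sp; apply/dist_le; first exact: edge_conn.
by exists p.
Qed.

Lemma dist_lt_size v : d v < #|N|.
Proof.
have /connectP[p pp lp] := edge_conn r v.
case/shortenP: pp lp => q pq uq _ lq.
apply: leq_trans (max_card (mem (r :: q))); rewrite (card_uniqP uq) ltnS.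
by apply/dist_le; [exact: edge_conn|exists q].
Qed.

End Distance.

Lemma size_ports (N : network) (u : N) : size (ports u) = degree u.
Proof.
rewrite /degree -(card_uniqP (ports_uniq u)); apply: eq_card => v.
by rewrite mem_ports.
Qed.

Lemma onth_ports (N : network) (u v : N) i :
  onth (ports u) i = Some v <-> edge u v /\ index v (ports u) = i.
Proof.
split=> [ui|[uv <-]]; last by rewrite onthE (nth_map v) ?index_mem ?nth_index ?mem_ports.
have lt : i < size (ports u) by rewrite -onthTE ui.
by have <- := onth_nth v _ _ _ ui; rewrite -mem_ports mem_nth // index_uniq // ports_uniq.
Qed.

(** * Synchronous algorithms with a common start *)

(* [Some None] is the wake-up signal, which every node sends to all its ports in round [0]. *)
Record alg D := Alg {
  letter : finType;
  astate : finType;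
  ini : bool -> {ffun 'I_D -> bool} -> astate;
  nxt : astate -> bool -> {ffun 'I_D -> option (option letter)} -> astate;
  out : astate -> 'I_D -> option (option letter);
  res : astate -> seq bool
}.

Section Execution.
Variables (D : nat) (A : alg D) (N : network) (r : N) (ph : nat -> bool).

Definition sent_to (S : N -> astate A) (u v : N) : option (option (letter A)) :=
  if insub (index v (ports u)) is Some p then out (S u) p else None.

Definition recv (S : N -> astate A) (v : N) :
  {ffun 'I_D -> option (option (letter A))} :=
  [ffun p : 'I_D => if onth (ports v) p is Some u then sent_to S u v else None].

Fixpoint exec t (v : N) : astate A :=
  if t is t'.+1 then nxt (exec t' v) (ph t') (recv (exec t') v)
  else ini A (v == r) [ffun p : 'I_D => p < size (ports v)].

End Execution.

Lemma sum_blocks (h k : nat -> nat) M :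
  (forall s, \sum_(i < M) h (M * s + i) <= k s) ->
  forall R, \sum_(x < M * R) h x <= \sum_(s < R) k s.
Proof.
move=> H; elim=> [|R IH]; first by rewrite muln0 big_ord0.
by rewrite mulnSr big_split_ord big_ord_recr /= leq_add.
Qed.

Lemma sum_leq_extend (h : nat -> nat) m n : m <= n ->
  \sum_(i < m) h i <= \sum_(i < n) h i.
Proof. by move=> /subnKC <-; rewrite big_split_ord /= leq_addr. Qed.

(** This compares a sum over global rounds with the sum over the local times of a node that starts
    [a] rounds late. *)
Lemma sum_shift (h : nat -> nat) a R :
  \sum_(g < R) (if a <= g then h (g - a) else 0) <= \sum_(x < R) h x.
Proof.
apply: leq_trans (_ : \sum_(x < R - a) h x <= _); last by rewrite sum_leq_extend ?leq_subr.
elim: R => [|R IH]; first by rewrite !big_ord0.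
rewrite big_ord_recr /=; case: (leqP a R) => aR; first by rewrite (subSn aR) big_ord_recr leq_add2r.
by rewrite addn0 (leq_trans IH) // sum_leq_extend // leq_sub2r.
Qed.

Lemma sum_pred_card (T : finType) (P : pred T) : \sum_x (P x : nat) = #|P|.
Proof.
rewrite -sum1_card [RHS]big_mkcond; apply: eq_bigr => x _.
by rewrite -topredE /=; case: (P x).
Qed.

(** * Simulation by Turing machines *)

Section Compile.
Variables (D : nat) (A : alg D) (C1 C2 : nat).

(** The wake-up signal [None] comes first: its code is 0, so it is sent in the very first step of a
    node. *)
Definition letters : seq (option (letter A)) := None :: [seq Some f | f <- enum (letter A)].
Definition code f := index f letters.
Definition decode i := nth None letters i.

Lemma codeK f : decode (code f) = f.
Proof.
by rewrite /decode nth_index //; case: f => [f|] //; rewrite inE map_f ?mem_enum ?orbT.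
Qed.

Lemma code_lt f : code f < size letters.
Proof. by rewrite index_mem; case: f => [f|] //; rewrite inE map_f ?mem_enum ?orbT. Qed.

(* A letter [f] is sent in step [3 * code f] of a frame. Whatever the skew, it is received
   in one of the steps [3 * code f + i] with [i < 3]; the last step updates the state. *)
Definition frame := (3 * size letters).+1.

(** Step within the frame, letters received in this frame, simulated state, direction of the clock
    head, number of overflows. *)
Definition rstate : finType :=
  ('I_frame * {ffun 'I_D -> option (option (letter A))} * astate A * bool * 'I_C2.+1)%type.

Definition max_res := \max_(q : astate A) size (res q).

Definition wstate : finType := (astate A * 'I_max_res.+1)%type.

Definition cstate : finType := option (rstate + wstate).

Local Notation reading := (tape_name D 0 -> symbol).
Local Notation actions := (tape_name D 0 -> symbol * head_move).

Definition outsym (q : astate A) (i : nat) (p : 'I_D) : symbol :=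
  if out q p is Some f then if i == 3 * code f then Some true else None else None.

(** The last step of a frame, number [3 * size letters], uses [buf] rather than [buf']: all letters
    have arrived by the step before it. *)
Definition run_step (x : rstate) (rd : reading) : cstate * actions :=
  let: (i, buf, q, up, c) := x in
  if C2 <= c then (Some (inr (q, ord0)), fun x => (rd x, Stay)) else
  let buf' := [ffun p : 'I_D => if rd (Tin p) is Some _ then Some (decode (i %/ 3)) else buf p] in
  let up' := (clock_act up (rd Tsize)).1 in
  let c' := inord (clock_overflow up (rd Tsize) + c) in
  (Some (inl (if i == frame.-1 :> nat
              then (ord0, [ffun=> None], nxt q (C1 <= c) buf, up', c')
              else (inord i.+1, buf', q, up', c'))),
   fun x => match x with
            | Tsize => (clock_act up (rd Tsize)).2
            | Tout p => (outsym q i p, Stay)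
            | _ => (rd x, Stay)
            end).

Definition write_step (x : wstate) (rd : reading) : cstate * actions :=
  let: (q, j) := x in
  (Some (inr (q, inord j.+1)),
   fun x => match x with
            | Tresult => (nth None [seq Some b | b <- res q] j, Rgt)
            | _ => (rd x, Stay)
            end).

(** In state [None] the node has not started. Since [bits] is never empty, a port exists iff the
    first symbol of its [Tnbr] tape is not blank. *)
Definition cdelta (s : cstate) (rd : reading) : cstate * actions :=
  match s with
  | None => run_step (ord0, [ffun=> None],
                      ini A (rd Trequest == Some true) [ffun p => rd (Tnbr p) != None],
                      true, ord0) rd
  | Some (inl x) => run_step x rd
  | Some (inr x) => write_step x rd
  end.

Definition chalt (s : cstate) : bool :=
  if s is Some (inr (q, j)) then j == size (res q) :> nat else false.

Definition compile : machine D := @Machine D cstate None predT chalt 0 cdelta.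

(** * Correctness of the simulation on a network *)

Variables (N : network) (r : N).
Hypothesis degD : forall u : N, degree u <= D.
Hypothesis out_ini : forall b P p, out (ini A b P) p = Some None.

Local Notation d := (dist (@edge N) r).
Local Notation n := #|N|.
Local Notation M := frame.

Fixpoint gconf g (v : N) : nconf compile :=
  if g is g'.+1 then
    let c0 := deliver (inbox (gconf g') v) (gconf g' v) in
    if awake c0 && ~~ halted (gconf g' v) then step c0 else c0
  else init_conf compile r v.

(** The phase bit is read in the last step of frame [t]. It depends on local time only, so all nodes
    change phase in the same simulated round. *)
Definition phase t : bool := C1 <= overflows n (M * t + M.-1).

Local Notation E := (exec A r phase).

Variable t2 : nat.
Hypothesis t2P : forall t, (C2 <= overflows n t) = (t2 <= t).
Hypothesis C2_gt0 : 0 < C2.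

(** A bit sent in step [3 * code f] of a frame of [u] is read by [v] in its own step
    [3 * code f + d u + 1 - d v]; the test says that this step is over, and avoids subtraction. *)
Definition buf_at v t : {ffun 'I_D -> option (option (letter A))} :=
  [ffun p : 'I_D => if onth (ports v) p is Some u then
     obind (fun f => if 3 * code f + d u + 1 < d v + t %% M then Some f else None)
           (sent_to (E (t %/ M)) u v) else None].

Definition rst v t : rstate :=
  (inord (t %% M), buf_at v t, E (t %/ M) v, (clock n t).1.1, inord (overflows n t)).

(** Local step [t] of [v] takes place in global round [d v + t], so the output found in
    configuration [g] was written in local step [g - d v - 1]. *)
Definition sym_at g v p : symbol :=
  if d v < g <= d v + t2 then
    outsym (E ((g - d v - 1) %/ M) v) ((g - d v - 1) %% M) p else None.

Lemma port_lt (u v : N) : edge u v -> index v (ports u) < D.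
Proof.
move=> uv; apply: leq_trans (degD u); rewrite -size_ports index_mem.
by rewrite mem_ports.
Qed.

Lemma insub_port (u v : N) (uv : edge u v) :
  insub (index v (ports u)) = Some (Ordinal (port_lt uv)).
Proof. by rewrite insubT ?port_lt // => lt; congr Some; apply: val_inj. Qed.

Lemma sent_to_edge S (u v : N) (uv : edge u v) :
  sent_to S u v = out (S u) (Ordinal (port_lt uv)) :> option (option (letter A)).
Proof. by rewrite /sent_to insub_port. Qed.

Lemma frame_divmod t i : i < M -> ((M * t + i) %/ M = t) * ((M * t + i) %% M = i).
Proof.
by move=> iM; rewrite mulnC divnMDl // modnMDl divn_small // modn_small // addn0.
Qed.

Definition arrival g v (p : 'I_D) : symbol :=
  if onth (ports v) p is Some u then
    if insub (index v (ports u)) is Some q then sym_at g u q else None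
  else None.

Lemma arrivalE v (p : 'I_D) u t (f := sent_to (E (t %/ M)) u v) :
  onth (ports v) p = Some u -> t < t2 ->
  arrival (d v + t) v p =
  (if f is Some f then
     if 3 * code f + d u + 1 == d v + t %% M then Some true else None
   else None).
Proof.
move=> pu tt2; rewrite /arrival pu; have /onth_ports[vu _] := pu.
have uv : edge u v by rewrite edge_sym.
have duv := dist_edge r uv; have dvu := dist_edge r vu.
rewrite /f sent_to_edge insub_port.
set q := Ordinal _; rewrite /sym_at.
have iM : t %% M < M by rewrite ltn_mod.
have tE : t = M * (t %/ M) + t %% M by rewrite mulnC -divn_eq.
set i := t %% M in iM tE *; set tau := t %/ M in tE *.
have MM : M = (3 * size letters).+1 by [].
have L0 : 0 < size letters by [].
case: (leqP (d u + 1) (d v + i)) => [le|gt].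
  have xE : d v + t - d u - 1 = M * tau + (d v + i - d u - 1) by rewrite tE; lia.
  have lM : d v + i - d u - 1 < M by lia.
  rewrite xE !(frame_divmod _ lM) /outsym.
  case: (out _ _) => [f'|]; last by case: ifP.
  have -> : (d u < d v + t <= d u + t2) by lia.
  by congr (if _ then _ else _); lia.
(* The symbol was written in one of the last two steps of the preceding frame of [u], or before [u]
   started; no letter has its slot there. *)
transitivity (None : symbol).
  case: ifP => // h.
  have tau0 : 0 < tau by rewrite lt0n; apply/eqP => e; move: h; rewrite tE e muln0; lia.
  have xE : d v + t - d u - 1 = M * tau.-1 + (M + (d v + i) - d u - 1).
    by rewrite tE; case: (tau) tau0 => // a _; rewrite mulnS; lia.
  have lM : M + (d v + i) - d u - 1 < M by lia.
  rewrite xE !(frame_divmod _ lM) /outsym; case: (out _ _) => // f'.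
  have := code_lt f'; case: ifP => //; lia.
case: (out _ _) => // f'; case: ifP => //; lia.
Qed.

Lemma buf_at_last v t : t %% M = M.-1 -> buf_at v t = recv (E (t %/ M)) v.
Proof.
move=> tM; apply/ffunP => p; rewrite !ffunE; case pu: onth => [u|] //.
have /onth_ports[vu _] := pu; have uv : edge u v by rewrite edge_sym.
have dvu := dist_edge r vu.
case: sent_to => //= f; have := code_lt f; rewrite tM /frame => fl.
by rewrite ifT //; lia.
Qed.

Lemma succ_divmod t : t %% M != M.-1 ->
  (t.+1 %/ M = t %/ M) * (t.+1 %% M = (t %% M).+1).
Proof.
move=> h; have iM : t %% M < M by rewrite ltn_mod.
have lM : (t %% M).+1 < M by rewrite /frame in h iM *; lia.
have tE : t.+1 = M * (t %/ M) + (t %% M).+1 by rewrite addnS mulnC -divn_eq.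
by rewrite tE !(frame_divmod _ lM).
Qed.

Lemma succ_divmod_last t : t %% M = M.-1 ->
  (t.+1 %/ M = (t %/ M).+1) * (t.+1 %% M = 0).
Proof.
move=> h; have tE : t.+1 = M * (t %/ M).+1 + 0.
  by rewrite addn0 mulnS [in LHS](divn_eq t M) h mulnC -addnS addnC.
by rewrite tE !frame_divmod.
Qed.

Lemma buf_at_first v t : t %% M = 0 -> buf_at v t = [ffun=> None].
Proof.
move=> tM; apply/ffunP => p; rewrite !ffunE; case pu: onth => [u|] //.
have /onth_ports[vu _] := pu; have uv : edge u v by rewrite edge_sym.
have duv := dist_edge r uv.
by case: sent_to => //= f; rewrite tM ifF //; lia.
Qed.

Lemma buf_at_succ v t : t < t2 -> t %% M != M.-1 ->
  buf_at v t.+1 = [ffun p : 'I_D =>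
    if arrival (d v + t) v p is Some _ then Some (decode (t %% M %/ 3)) else buf_at v t p].
Proof.
move=> tt2 tM; have [dE mE] := succ_divmod tM.
apply/ffunP => p; rewrite !ffunE dE mE; case pu: onth => [u|]; last first.
  by rewrite /arrival pu.
rewrite (arrivalE pu tt2).
have /onth_ports[vu _] := pu; have uv : edge u v by rewrite edge_sym.
have duv := dist_edge r uv; have dvu := dist_edge r vu.
case: sent_to => //= f.
case: eqP => [eq|ne].
  have -> : t %% M %/ 3 = code f by lia.
  by rewrite codeK ifT //; lia.
by congr (if _ then _ else _); lia.
Qed.

Lemma overflow_lt t : t < t2 -> overflows n t < C2.
Proof. by move=> tt2; rewrite ltnNge t2P -ltnNge. Qed.

Lemma clockS t : clock n t.+1 =
  ((clock_act (clock n t).1.1 (here (clock n t).1.2)).1,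
   act_tape (clock_act (clock n t).1.1 (here (clock n t).1.2)).2 (clock n t).1.2,
   clock_overflow (clock n t).1.1 (here (clock n t).1.2) + overflows n t).
Proof. by rewrite /overflows {1}/clock iterS -/(clock n t); case: (clock n t) => [[]]. Qed.

Lemma overflowsS t : overflows n t.+1 =
  clock_overflow (clock n t).1.1 (here (clock n t).1.2) + overflows n t.
Proof. by rewrite {1}/overflows clockS. Qed.

Lemma run_stepE v t (rd : reading) : t < t2 ->
  rd Tsize = here (clock n t).1.2 ->
  (forall p, rd (Tin p) = arrival (d v + t) v p) ->
  run_step (rst v t) rd =
  (Some (inl (rst v t.+1)),
   fun x => match x with
            | Tsize => (clock_act (clock n t).1.1 (here (clock n t).1.2)).2
            | Tout p => (outsym (E (t %/ M) v) (t %% M) p, Stay)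
            | _ => (rd x, Stay)
            end).
Proof.
move=> tt2 rdn rdin; have oC := overflow_lt tt2.
have iM : t %% M < M by rewrite ltn_mod.
rewrite /run_step {1}/rst !inordK ?(ltn_trans oC) // leqNgt oC /= rdn.
congr (Some (inl _), _); rewrite /rst overflowsS clockS.
case: eqP => [tM|/eqP tM].
  rewrite (buf_at_last v tM) (@buf_at_first v t.+1) ?(succ_divmod_last tM) //.
  congr (_, _, nxt _ _ _, _, _).
    by apply: val_inj; rewrite /= inordK.
  by rewrite /phase; congr (_ <= overflows _ _); rewrite -[M.-1]tM mulnC -divn_eq.
rewrite buf_at_succ // !(succ_divmod tM); congr (_, _, _, _, _).
by apply/ffunP => p; rewrite !ffunE rdin.
Qed.

(** Local time has three regimes: before the start, simulation up to [t2], then output. Step [t2]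
    only switches regime, hence [t - t2 - 1] bits are written at time [t], up to the length of the
    result. *)
Definition lspec v t (c : nconf compile) : Prop :=
  if t is 0 then
    [/\ control c = None, tapes c Tsize = load (bits n), tapes c Tresult = load [::],
        tapes c Trequest = load [:: v == r] &
        forall p, tapes c (Tnbr p) =
          if onth (ports v) p is Some u then load (bits (ident u)) else load [::]]
  else if t <= t2 then
    [/\ control c = Some (inl (rst v t)), tapes c Tsize = (clock n t).1.2 &
        tapes c Tresult = load [::]]
  else let j := minn (t - t2 - 1) (size (res (E (t2 %/ M) v))) in
    control c = Some (inr (E (t2 %/ M) v, inord j)) /\
    tapes c Tresult = Tape (rev [seq Some b | b <- take j (res (E (t2 %/ M) v))]) None [::].

Definition spec g v (c : nconf compile) : Prop :=
  [/\ awake c = (d v < g) || (v == r),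
      forall p, tapes c (Tout p) = Tape [::] (sym_at g v p) [::] &
      lspec v (g - d v) c].

Lemma t2_gt0 : 0 < t2.
Proof.
rewrite lt0n; apply/eqP => t20; have := t2P 0; rewrite t20 leqnn.
by rewrite /overflows /clock /= leqNgt C2_gt0.
Qed.

Lemma message_spec g u c (p : 'I_D) : spec g u c -> message c p = pmap id [:: sym_at g u p].
Proof.
by case=> _ H _; rewrite /message valK H.
Qed.

Lemma inbox_spec g v (p : 'I_D) : (forall u, spec g u (gconf g u)) ->
  inbox (gconf g) v p = pmap id [:: arrival g v p].
Proof.
move=> IH; rewrite /inbox /arrival; case pu: onth => [u|] //.
have /onth_ports[vu _] := pu; have uv : edge u v by rewrite edge_sym.
by rewrite insub_port -(message_spec (Ordinal (port_lt uv)) (IH u)).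
Qed.

Lemma rst0 v (rd : reading) : rd Trequest = Some (v == r) ->
  (forall p, rd (Tnbr p) =
     if onth (ports v) p is Some u then here (load (bits (ident u))) else None) ->
  cdelta None rd = run_step (rst v 0) rd.
Proof.
move=> rdr rdn; rewrite /cdelta /rst mod0n div0n buf_at_first //.
congr (run_step (_, _, _, _, _) _); try by apply: val_inj; rewrite /= inordK.
rewrite /= rdr; congr (ini _ _ _); first by case: (v == r).
apply/ffunP => p; rewrite !ffunE rdn.
case: (ltnP p (size (ports v))) => [lt|ge].
  by rewrite onthE (nth_map v).
by rewrite onth_default.
Qed.

Lemma arrival_none v g (p : 'I_D) : g < d v -> arrival g v p = None.
Proof.
move=> gv; rewrite /arrival; case pu: onth => [u|] //.
have /onth_ports[vu _] := pu; have uv : edge u v by rewrite edge_sym.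
have duv := dist_edge r uv.
by rewrite insub_port /sym_at ifF //; lia.
Qed.

Lemma arrival_wake v : v != r -> exists p, arrival (d v) v p != None.
Proof.
move=> vr; have [u uv duv] := dist_pred vr.
have vu : edge v u by rewrite edge_sym.
exists (Ordinal (port_lt vu)); rewrite /arrival.
have -> : onth (ports v) (Ordinal (port_lt vu)) = Some u by apply/onth_ports.
have t20 := t2_gt0.
rewrite insub_port /sym_at ifT; last lia.
have -> : d v - d u - 1 = 0 by lia.
by rewrite div0n mod0n /outsym /= out_ini.
Qed.

(** Every node sends the signal in its first step, so the wave advances one hop per round: nothing
    reaches [v] before round [d v], and a neighbour closer to [r] wakes it in that round. *)
Lemma awake_deliver g v : (forall u, spec g u (gconf g u)) ->
  awake (deliver (inbox (gconf g) v) (gconf g v)) = (d v <= g).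
Proof.
move=> IH; have [aw _ _] := IH v; rewrite /= {}aw.
have -> : [exists i : 'I_D, inbox (gconf g) v i != [::]] = [exists i, arrival g v i != None].
  by apply: eq_existsb => i; rewrite inbox_spec //=; case: arrival.
case: ltngtP => //= [gv|dv].
  have -> /= : (v == r) = false by apply/eqP => e; rewrite e dist_root in gv.
  by apply/existsP => -[p]; rewrite arrival_none.
case: eqVneq => //= vr; have [p] := arrival_wake vr; rewrite dv => h.
by apply/existsP; exists p.
Qed.

Lemma size_res (q : astate A) : size (res q) <= max_res.
Proof. exact: (leq_bigmax (F := fun q : astate A => size (res q))). Qed.

(** A step adds at most one overflow, so the threshold [C2] is reached with equality and the bounded
    counter in [rstate] suffices. *)
Lemma overflows_end : overflows n t2 = C2.
Proof.
apply/eqP; rewrite eqn_leq t2P leqnn andbT.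
have := t2_gt0; case: t2 t2P overflow_lt => // t _ /(_ t (leqnn _)) lt _.
rewrite overflowsS; apply: leq_trans lt; rewrite -addn1 addnC leq_add2l.
exact: leq_b1.
Qed.

Lemma gconf_spec g v : spec g v (gconf g v).
Proof.
elim: g v => [|g IH] v; first by split; rewrite ?ltn0 ?sub0n //=; split.
have aw := awake_deliver v IH; have [_ Hout Hl] := IH v.
have -> : gconf g.+1 v = let c0 := deliver (inbox (gconf g) v) (gconf g v) in
    if (d v <= g) && ~~ halted (gconf g v) then step c0 else c0 by rewrite -aw.
have t20 := t2_gt0.
have awS : (d v < g.+1) || (v == r) = (d v <= g).
  by rewrite ltnS; case: eqVneq => [->|]; rewrite ?dist_root ?orbF.
case: (leqP (d v) g) => [dvg|gdv]; last first.
  split=> [|p|]; first by rewrite awS -aw.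
  - by rewrite /= /sym_at ifF //; lia.
  - have e : g.+1 - d v = 0 by lia.
    have e' : g - d v = 0 by lia.
    by rewrite e'/= in Hl; rewrite e.
set t := g - d v in Hl.
have gE : g = d v + t by rewrite /t; lia.
have tS : g.+1 - d v = t.+1 by lia.
set c := gconf g v in Hl Hout *; set c0 := deliver _ c.
have Tn x : (if x is Tin _ then false else if x is Tout _ then false else true) ->
   tapes c0 x = tapes c x by case: x.
have inE p : here (tapes c0 (Tin p)) = arrival (d v + t) v p.
  by rewrite /= inbox_spec // -gE; case: arrival.
have outE p : tapes c0 (Tout p) = load [::] by [].
case: (ltngtP t t2) => [lt|gt|e].
- set rd := fun x => here (tapes c0 x).
  have ctl : cdelta (control c0) rd = run_step (rst v t) rd.
    move: lt Hl; case: (t) => [|t'] lt /=; last by rewrite ltnW // => -[-> _ _].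
    by case=> -> _ _ Hr Hn; apply: rst0 => [|p]; rewrite /rd ?Tn // ?Hr // Hn; case: onth.
  have sizeE : tapes c Tsize = (clock n t).1.2.
    by move: lt Hl; case: (t) => [|t'] lt /=; [case|rewrite ltnW // => -[]].
  have resE : tapes c Tresult = load [::].
    by move: lt Hl; case: (t) => [|t'] lt /=; [case|rewrite ltnW // => -[]].
  have rdn : rd Tsize = here (clock n t).1.2 by rewrite /rd Tn // sizeE.
  have hc : halted c = false.
    move: lt Hl; rewrite /halted; case: (t) => [|t'] lt /=; last by rewrite ltnW // => -[-> _ _].
    by case=> ->.
  rewrite hc /= /step /= ctl run_stepE //.
  split=> [|p|] /=; first by rewrite ltnS dvg.
    rewrite /sym_at ifT; last lia.
    by have -> : g.+1 - d v - 1 = t by lia.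
  by rewrite tS /= lt /rd /= sizeE resE clockS.
- have nle : t <= t2 = false by lia.
  move: Hl; rewrite /lspec; case tE: (t) => [|t']; first lia.
  rewrite -tE nle; set q := E _ v; set j := minn _ _ => -[ctl rE].
  have jr : j < max_res.+1 by rewrite ltnS (leq_trans (geq_minr _ _)) // size_res.
  have nle' : t < t2 = false by lia.
  have symE p : sym_at g.+1 v p = None by rewrite /sym_at ifF //; lia.
  case: (ltnP j (size (res q))) => [ljs|lsj].
    have hc : halted c = false.
      by rewrite /halted ctl /= inordK //; apply/eqP; lia.
    rewrite hc /= /step /= ctl /=; split=> [|p|] /=; first by rewrite ltnS dvg.
      by rewrite symE.
    rewrite tS /= nle' -/q.
    have -> : minn (t.+1 - t2 - 1) (size (res q)) = j.+1 by rewrite /j -/q in ljs *; lia.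
    rewrite inordK //; split=> //; rewrite rE /= (take_nth false) //.
    by rewrite map_rcons rev_rcons (nth_map false).
  have jE : j = size (res q).
    by apply/eqP; rewrite eqn_leq lsj andbT; apply: geq_minr.
  have hc : halted c by rewrite /halted ctl /= inordK // jE.
  rewrite hc /=; split=> [|p|] /=; first by rewrite awS -aw.
    by rewrite symE.
  rewrite tS /= nle' -/q.
  have -> : minn (t.+1 - t2 - 1) (size (res q)) = j by rewrite /j -/q in jE lsj *; lia.
  by [].
move: Hl; rewrite /lspec; case tE: (t) => [|t']; first lia.
rewrite -tE e leqnn => -[ctl _ rE].
have hc : halted c = false by rewrite /halted ctl.
rewrite hc /= /step /= ctl /= inordK ?overflows_end // leqnn /=.
split=> [|p|] /=; first by rewrite ltnS dvg.
  by rewrite /sym_at ifF //; lia.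
rewrite tS /= e ltnn.
have -> : t2.+1 - t2 - 1 = 0 by lia.
rewrite min0n take0 rE; split=> //; congr (Some (inr (_, _))).
by apply: val_inj; rewrite /= inordK.
Qed.

Lemma gconf_halts g v : d v + t2 + max_res < g -> halted (gconf g v).
Proof.
move=> h; have [_ _] := gconf_spec g v; rewrite /lspec.
case tE: (g - d v) => [|t]; first lia.
rewrite -tE ifF; last lia.
case=> ctl _; rewrite /halted ctl /=.
have sr := size_res (E (t2 %/ M) v).
by rewrite (minn_idPr _) ?inordK //; lia.
Qed.

Lemma gconf_result g v : halted (gconf g v) ->
  word (tapes (gconf g v) Tresult) = res (E (t2 %/ M) v).
Proof.
have [_ _] := gconf_spec g v; rewrite /lspec /halted.
case: (g - d v) => [|t]; first by case=> ->.
case: ifP => _; first by case=> ->.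
case=> -> -> /=; rewrite inordK; last by rewrite ltnS (leq_trans (geq_minr _ _)) // size_res.
move/eqP=> ->; rewrite take_size /word /= revK.
by rewrite pmap_cat /= cats0; elim: (res _) => //= b s ->.
Qed.

Lemma size_message g v (p : 'I_D) : size (message (gconf g v) p) <= 1.
Proof. by rewrite (message_spec p (gconf_spec g v)) /=; case: sym_at. Qed.

(** A letter of simulated round [s] costs a single nonempty message, in its slot of frame [s]. The
    delay [d v] is shifted away, then [R] local steps are extended to [R] whole frames. *)
Lemma messages_sent v (p : 'I_D) R :
  \sum_(g < R) (message (gconf g.+1 v) p != [::]) <=
  \sum_(s < R) (out (E s v) p != None).
Proof.
pose h x : nat := outsym (E (x %/ M) v) (x %% M) p != None.
apply: leq_trans (_ : \sum_(g < R) (if d v <= g then h (g - d v) else 0) <= _).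
  apply: leq_sum => g _; rewrite (message_spec p (gconf_spec g.+1 v)) /= /sym_at.
  rewrite ltnS; case: (leqP (d v) g) => //= dvg.
  have -> : g.+1 - d v - 1 = g - d v by lia.
  by case: ifP => // _; rewrite /h; case: outsym.
apply: leq_trans (sum_shift h (d v) R) _.
apply: leq_trans (sum_leq_extend h (_ : R <= M * R)) _; first by rewrite leq_pmull.
apply: (@sum_blocks h (fun s => out (E s v) p != None)) => s.
rewrite (eq_bigr (fun i : 'I_M => (outsym (E s v) i p != None) : nat)); last first.
  by move=> i _; rewrite /h !frame_divmod.
rewrite /outsym; case: (out _ _) => [f|]; last by rewrite big1.
have fM : 3 * code f < M by have := code_lt f; rewrite /frame; lia.
rewrite (bigD1 (Ordinal fM)) //= eqxx big1 // => i /eqP ne.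
by rewrite ifF //; apply/eqP => e; case: ne; apply: val_inj.
Qed.

Lemma compile_run B :
  (forall v T, \sum_(s < T) #|[pred p | out (E s v) p != None]| <= B) ->
  exists R : run compile r,
    [/\ forall v, word (tapes (conf R (rounds R) v) Tresult) = res (E (t2 %/ M) v),
        in_time_per_round R <= 1, dist_time R <= n + t2 + max_res.+1,
        msg_size R <= 1 & msg_per_node R <= B].
Proof.
move=> HB; pose all_halt g := [forall v, halted (gconf g v)].
have hT : all_halt (n + t2 + max_res.+1).
  by apply/forallP => v; apply: gconf_halts; have := dist_lt_size r v; lia.
(* The run ends in the first round in which all nodes have halted, as [run_first] demands. *)
have ex : exists g, all_halt g by exists (n + t2 + max_res.+1).
case: (ex_minnP ex) => T hall Tmin.
pose act g v := awake (deliver (inbox (gconf g) v) (gconf g v)) && ~~ halted (gconf g v).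
have rr i v : i < T -> node_round (inbox (gconf i) v) (gconf i v) (act i v) (gconf i.+1 v).
  move=> _; have -> : gconf i.+1 v = let c0 := deliver (inbox (gconf i) v) (gconf i v) in
    if act i v then step c0 else c0 by [].
  by rewrite /node_round; cbv zeta; rewrite -/(act i v); case: (act i v); split=> //; case.
have rh v : halted (gconf T v) by exact: (forallP hall).
have rf i : i < T -> exists v, ~~ halted (gconf i v).
  move=> iT; apply/existsP; rewrite -negb_forall; apply/negP => /Tmin.
  by rewrite leqNgt iT.
exists (@Run D compile N r T gconf act (fun v => erefl) rr rh rf); split=> /=.
- by move=> v; apply: gconf_result.
- by apply/bigmax_leqP => i _; apply/bigmax_leqP => v _; apply: leq_b1.
- exact: Tmin.
- apply/bigmax_leqP => i _; apply/bigmax_leqP => v _; apply/bigmax_leqP => p _.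
  exact: size_message.
apply/bigmax_leqP => v _; apply: leq_trans (HB v T).
under eq_bigr => i _ do rewrite -sum_pred_card.
under [X in _ <= X]eq_bigr => i _ do rewrite -sum_pred_card.
rewrite exchange_big [X in _ <= X]exchange_big /=; apply: leq_sum => p _.
exact: messages_sent.
Qed.

End Compile.

Arguments exec : simpl never.

(** * Local flooding *)

(* A step [(j, i)] of an address leaves through port [j] and enters through port [i]. *)
Definition addr D K : finType := K.-bseq ('I_D * 'I_D).

(** Entry ports are part of an address so that a neighbour of the token holder can recognize, by the
    holder's port number, that the token is meant for it. *)
Fixpoint walk D (N : network) (a : N) (p : seq ('I_D * 'I_D)) : option N :=
  if p is (j, i) :: p' then
    if onth (ports a) j is Some u then
      if index a (ports u) == i then walk u p' else None
    else None
  else Some a.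

Record falg D K := FAlg {
  payload : finType;
  fstate : finType;
  fini : bool -> {ffun 'I_D -> bool} -> fstate;
  pay : fstate -> option payload;
  upd : fstate -> bool -> {ffun addr D K -> option payload} -> fstate;
  fres : fstate -> seq bool
}.

Section Flood.
Variables (D K : nat) (F : falg D K).

Local Notation view_t := {ffun addr D K -> option (payload F)}.

Definition view (N : network) (S : N -> fstate F) (v : N) : view_t :=
  [ffun p : addr D K => obind (fun u => pay (S u)) (walk v p)].

Fixpoint fexec (N : network) (r : N) (ph : nat -> bool) e (v : N) : fstate F :=
  if e is e'.+1 then upd (fexec r ph e' v) (ph e') (view (fexec r ph e') v)
  else fini F (v == r) [ffun p : 'I_D => p < size (ports v)].

Definition no_view : view_t := [ffun=> None].

(** The first component is the port of the sender, from which the receiver learns the entry port of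
    its addresses. *)
Definition flood_letter : finType := ('I_D * view_t)%type.

Definition flood_state : finType := (bool * fstate F * 'I_K.+1 * view_t)%type.

Definition merge (s : fstate F) (inb : {ffun 'I_D -> option (option flood_letter)}) : view_t :=
  [ffun p : addr D K => match val p with
    | [::] => pay s
    | (j, i) :: p' =>
        if inb j is Some (Some (i', w)) then
          if i' == i then obind w (insub p') else None
        else None
    end].

(** An empty view is conveyed by silence; the bound on the number of messages rests on this. *)
Definition flood_out (x : flood_state) (p : 'I_D) : option (option flood_letter) :=
  let: (b, s, h, acc) := x in
  if b then if acc == no_view then None else Some (Some (p, acc)) else Some None.

Definition flood_nxt (x : flood_state) (ph : bool)
    (inb : {ffun 'I_D -> option (option flood_letter)}) : flood_state :=
  let: (b, s, h, acc) := x in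
  if b then
    if h == K :> nat then (true, upd s ph (merge s inb), ord0, no_view)
    else (true, s, inord h.+1, merge s inb)
  else (true, s, ord0, no_view).

Definition flood : alg D :=
  @Alg D flood_letter flood_state (fun b P => (false, fini F b P, ord0, no_view))
    flood_nxt flood_out (fun x => fres x.1.1.2).

Variables (N : network) (r : N) (ph : nat -> bool).
Hypothesis degD : forall u : N, degree u <= D.

Definition fphase e := ph (K.+1 * e + K).+1.

Local Notation E := (exec flood r ph).
Local Notation S := (fexec r fphase).

Definition part_view e h v : view_t :=
  [ffun p : addr D K => if size p < h then view (S e) v p else None].

(** The entry at [(j, i) :: p'] is the entry at [p'] of the neighbour behind port [j], so each round
    fills the addresses that are one step longer. *)
Lemma merge_part_view e h (X : N -> astate flood) v :
  (forall u, X u = (true, S e u, inord h, part_view e h u)) ->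
  merge (S e v) (recv X v) = part_view e h.+1 v.
Proof.
move=> XE; apply/ffunP => -[p sp]; rewrite !ffunE /=.
case: p sp => [|[j i] p] sp //=.
rewrite !ffunE; case pu: onth => [u|]; last by rewrite if_same.
have /onth_ports[vu _] := pu; have uv : edge u v by rewrite edge_sym.
rewrite (sent_to_edge degD _ uv) XE /=.
have lp : size p <= K by apply: leq_trans sp.
set q : addr D K := Bseq lp.
have qE : insub p = Some q by rewrite insubT; congr Some; apply: val_inj.
set b := index v (ports u) == i.
transitivity (if b then part_view e h u q else None).
  case: ifP => [/eqP -> |_]; first by rewrite ffunE if_same.
  by rewrite qE -[Ordinal _ == i]val_eqE /=.
by rewrite !ffunE /= ltnS; case: b; case: ifP.
Qed.

Lemma execS t v : E t.+1 v = flood_nxt (E t v) (ph t) (recv (E t) v).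
Proof. by []. Qed.

(** The successor accounts for the wake-up round; after it each epoch takes [K.+1] rounds. *)
Lemma execE e h v : h <= K ->
  E (K.+1 * e + h).+1 v = (true, S e v, inord h, part_view e h v).
Proof.
have e0 e' u : part_view e' 0 u = no_view by apply/ffunP => p; rewrite !ffunE.
have i0 : inord 0 = ord0 :> 'I_K.+1 by apply: val_inj; rewrite /= inordK.
elim: e h v => [|e IHe] h v.
  rewrite muln0 add0n; elim: h v => [|h IHh] v hK; first by rewrite e0 i0.
  have {}IHh u := IHh u (ltnW hK).
  rewrite execS.
  by rewrite IHh /= inordK ?ltnS ?(ltnW hK) // ltn_eqF // (merge_part_view v IHh).
elim: h v => [|h IHh] v hK.
  have H u := IHe K u (leqnn K).
  have -> : (K.+1 * e.+1 + 0) = (K.+1 * e + K).+1 by rewrite mulnS; lia.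
  rewrite execS.
  rewrite H /= inordK // eqxx e0 i0 (merge_part_view v H); congr (_, upd _ _ _, _, _).
  by apply/ffunP => p; rewrite !ffunE ltnS (size_bseq p).
have {}IHh u := IHh u (ltnW hK).
rewrite addnS execS.
by rewrite IHh /= inordK ?ltnS ?(ltnW hK) // ltn_eqF // (merge_part_view v IHh).
Qed.

Lemma flood_result t v : res (E t.+1 v) = fres (S (t %/ K.+1) v).
Proof.
by rewrite {1}(divn_eq t K.+1) mulnC execE // -ltnS ltn_mod.
Qed.

Lemma flood_out_ini b P p : out (ini flood b P) p = Some None.
Proof. by []. Qed.

(** Besides the [D] wake-up signals, [v] sends only in epochs in which some address of [v] shows a
    payload, and then at most [D] letters in each of [K.+1] rounds. Each of its addresses leads to
    at most one node, hence shows a payload in at most [c] epochs. *)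
Lemma flood_messages c :
  (forall u T, \sum_(e < T) (pay (S e u) != None) <= c) ->
  forall v T, \sum_(s < T) #|[pred p | out (E s v) p != None]| <=
              D + K.+1 * (D * (#|addr D K| * c)).
Proof.
move=> Hc v T.
pose h s := #|[pred p | out (E s v) p != None]|.
have hD s : h s <= D by rewrite -[X in _ <= X]card_ord max_card.
apply: leq_trans (sum_leq_extend h (_ : T <= (K.+1 * T).+1)) _.
  by rewrite ltnW // ltnS leq_pmull.
rewrite big_ord_recl leq_add //=.
pose k e := K.+1 * (D * \sum_(p : addr D K) (view (S e) v p != None)).
apply: leq_trans (@sum_blocks (fun x => h x.+1) k K.+1 _ T) _.
  move=> e; rewrite /k -[X in _ <= X * _](card_ord K.+1) -sum_nat_const.
  apply: leq_sum => i _; rewrite /h execE /=; last by rewrite -ltnS.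
  case: eqP => [_|/eqP ne].
    by rewrite (eq_card0 (A := [pred p | _])) // => p; rewrite inE eqxx.
  have [p pne] : exists p, part_view e i v p != None.
    apply/existsP; rewrite -[X in is_true X]negbK negb_exists; apply/negP => /forallP H.
    case/eqP: ne; apply/ffunP => p; rewrite [RHS]ffunE.
    by apply/eqP; have := H p; rewrite negbK.
  apply: leq_trans (_ : D * 1 <= _); first by rewrite muln1 -[X in _ <= X]card_ord max_card.
  rewrite leq_mul2l (bigD1 p) //= (_ : view (S e) v p != None) ?orbT //.
  by apply: contraNneq pne => vp; rewrite ffunE vp if_same.
rewrite /k -big_distrr leq_mul // -big_distrr leq_mul // exchange_big /=.
rewrite -sum_nat_const; apply: leq_sum => p _.
case wE: (walk v p) => [u|].
  by apply: leq_trans (Hc u T); apply: leq_sum => e _; rewrite ffunE wE.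
by rewrite big1 // => e _; rewrite ffunE wE.
Qed.

End Flood.

Lemma eq_view D K (F : falg D K) (N : network) (S S' : N -> fstate F) v :
  S =1 S' -> view S v = view S' v.
Proof. by move=> H; apply/ffunP => p; rewrite !ffunE; case: walk => //= u; rewrite H. Qed.

Lemma eq_fexec D K (F : falg D K) (N : network) (r : N) ph ph' e :
  ph =1 ph' -> fexec F r ph e =1 fexec F r ph' e.
Proof.
by move=> H; elim: e => // e IH v /=; rewrite IH H (eq_view v IH).
Qed.

Lemma falg_run D K (F : falg D K) (c1 c : nat) :
  exists (M : machine D) (c' : nat), forall (N : network) (r : N),
    (forall u : N, degree u <= D) ->
    (forall e1 u T, c1 * #|N| <= e1 ->
       \sum_(e < T) (pay (fexec F r (leq e1) e u) != None) <= c) ->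
    exists (R : run M r) (e1 e : nat),
      [/\ c1 * #|N| <= e1 /\ e1 + c1 * #|N| <= e,
          forall v, word (tapes (conf R (rounds R) v) Tresult) =
                    fres (fexec F r (leq e1) e v) &
          [/\ in_time_per_round R <= c', dist_time R <= c' * #|N|,
              msg_size R <= c' & msg_per_node R <= c']].
Proof.
(* [Fr] and [L] are the lengths of a frame and of an epoch in clock steps; epoch [e] reads its phase
   bit at step [L * e + a]. *)
have [Fr FrE] : {m | m = frame (flood F)} by exists (frame (flood F)).
have Fr0 : 0 < Fr by rewrite FrE.
have [L LE] : {m | m = Fr * K.+1} by exists (Fr * K.+1).
have L0 : 0 < L by rewrite LE muln_gt0 Fr0.
have [a aE] : {m | m = L + Fr - 1} by exists (L + Fr - 1).
(* Both before [t1] and between [t1] and [t2] there must be room for [c1 * n] epochs, up to the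
   losses from rounding to whole frames and epochs. *)
set cc := L * c1 + L + Fr + a + 5.
exists (compile (flood F) cc.+2 (2 * cc + 3)).
set mr := max_res (flood F).
exists (1 + (20 * cc + 100 + mr + 2) + (D + K.+1 * (D * (#|addr D K| * c)))).
move=> N r deg Hc.
have n0 : 0 < #|N| by apply/card_gt0P; exists r.
have [t1 [t2 [t1P t2P h1 h2 h3]]] := clock_phases cc n0.
have ex : exists e, t1 <= L * e + a by exists t1; rewrite (leq_trans (leq_pmull t1 L0)) // leq_addr.
(* The first epoch that reads the phase bit as set. *)
pose e1 := ex_minn ex.
have [e1P e1min] : t1 <= L * e1 + a /\ forall e, t1 <= L * e + a -> e1 <= e.
  by rewrite /e1; case: ex_minnP.
have phE : fphase K (phase (flood F) cc.+2 N) =1 leq e1.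
  move=> e; rewrite /fphase /phase t1P -FrE.
  have -> : Fr * (K.+1 * e + K).+1 + Fr.-1 = L * e + a.
    by rewrite aE LE; case: (Fr) Fr0 => // m _; rewrite !mulnS mulnDr mulnA; lia.
  apply/idP/idP; first exact: e1min.
  by move=> le; rewrite (leq_trans e1P) // leq_add2r leq_mul2l le orbT.
clearbody e1; have e1c : c1 * #|N| <= e1.
  rewrite leqNgt; apply/negP => lt.
  have := leq_mul (leqnn L) lt; have := leq_pmulr a n0.
  move: h1 e1P; rewrite /cc !mulnDl mulnS; lia.
have C20 : 0 < 2 * cc + 3 by lia.
have Hc' u T : \sum_(e < T)
    (pay (fexec F r (fphase K (phase (flood F) cc.+2 N)) e u) != None) <= c.
  have := Hc e1 u T e1c; congr (_ <= c); apply: eq_bigr => e _.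
  by rewrite (eq_fexec _ _ _ phE).
have msgs := flood_messages deg Hc'.
have [R [Rres Rt Rd Rs Rm]] := compile_run deg (@flood_out_ini _ _ F) t2P C20 msgs.
have e1u : L * e1 + a < t1 + L + a.
  case: (posnP e1) => [->|e1p]; first by rewrite muln0; lia.
  have : ~~ (t1 <= L * e1.-1 + a) by apply/negP => /e1min; lia.
  rewrite -ltnNge; case: (e1) e1p => // e' _; rewrite mulnS; lia.
have t2b : L * (e1 + c1 * #|N|) + Fr <= t2.
  have := leq_pmulr L n0; have := leq_pmulr Fr n0.
  move: h2 e1u; rewrite /cc !mulnDl mulnDr; lia.
have Tdiv : 0 < t2 %/ Fr by rewrite divn_gt0 //; lia.
exists R, e1, ((t2 %/ Fr).-1 %/ K.+1); split.
- split=> //; rewrite leq_divRL // -ltnS prednK // leq_divRL // mulSn.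
  by rewrite -mulnA [K.+1 * Fr]mulnC -LE mulnC addnC.
- by move=> v; rewrite Rres -FrE -[t2 %/ Fr]prednK // flood_result // (eq_fexec _ _ _ phE).
split; [lia| |lia|lia].
apply: leq_trans Rd _; rewrite -/mr; have := leq_pmulr mr n0.
move: h3; rewrite !mulnDl; lia.
Qed.

(** * Addresses *)

Section Walk.
Variables (D : nat) (N : network).
Hypothesis degD : forall u : N, degree u <= D.
Implicit Types (a u v : N) (p q : seq ('I_D * 'I_D)).

Lemma walk_cat a p q : walk a (p ++ q) = obind (fun u => walk u q) (walk a p).
Proof.
by elim: p a => [|[j i] p IH] a //=; case: onth => //= u; case: ifP.
Qed.

Lemma walk1 a u (j i : 'I_D) : walk a [:: (j, i)] = Some u <->
  onth (ports a) j = Some u /\ index a (ports u) = i.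
Proof.
rewrite /=; case E: onth => [w|]; last by split=> [|[]].
by case: eqP => h; split=> [|[]] // [<-].
Qed.

Lemma walk_edge a u : edge a u <-> exists x : 'I_D * 'I_D, walk a [:: x] = Some u.
Proof.
split=> [au|[[j i] /walk1[/onth_ports[]]]] //.
have ua : edge u a by rewrite edge_sym.
exists (Ordinal (port_lt degD au), Ordinal (port_lt degD ua)); apply/walk1.
by split=> //; apply/onth_ports.
Qed.

Lemma walk_path a p u : walk a p = Some u ->
  exists s, [/\ size s = size p, path (@edge N) a s & last a s = u].
Proof.
elim: p a => [|[j i] p IH] a /=; first by case=> <-; exists [::].
case aw: onth => [w|] //; case: ifP => // _ /IH[s [ss ps ls]].
by have /onth_ports[e _] := aw; exists (w :: s); rewrite /= ss e.
Qed.

Lemma path_walk a s : path (@edge N) a s ->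
  exists p : seq ('I_D * 'I_D), size p = size s /\ walk a p = Some (last a s).
Proof.
elim: s a => [|w s IH] a /=; first by exists [::].
case/andP=> /walk_edge[x xw] /IH[p [sp wp]]; exists (x :: p).
by split; [rewrite /= sp|rewrite -[x :: p]cat1s walk_cat xw].
Qed.

Lemma dist_walk a u m : dist (@edge N) a u <= m <->
  exists2 p : seq ('I_D * 'I_D), size p <= m & walk a p = Some u.
Proof.
split=> [/dist_le[|s [ss ps ls]]|[p sp /walk_path[s [ss ps ls]]]]; first exact: edge_conn.
  by have [p [e wp]] := path_walk ps; exists p; rewrite ?e // wp ls.
by apply/dist_le; [exact: edge_conn|exists s; rewrite ss].
Qed.

Lemma follow_walk a p u : walk a p = Some u ->
  follow a [seq nat_of_ord x.1 | x <- p] = Some u.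
Proof.
rewrite /follow; elim: p a => [|[j i] p IH] a //=.
by case: onth => // w; case: ifP => // _ /IH.
Qed.

End Walk.

(** * Depth-first search *)

Section DFS.
Variables (D : nat) (N : network) (r : N).
Hypothesis degD : forall u : N, degree u <= D.
Implicit Types (v u : N) (W : {set N}).

Definition fresh W v (j : 'I_D) : bool :=
  if onth (ports v) j is Some u then u \notin W else false.

Definition dfs_step (c : seq N * {set N}) : seq N * {set N} :=
  if c.1 is v :: s then
    if obind (onth (ports v) \o @nat_of_ord D) [pick j | fresh c.2 v j] is Some u
    then (u :: c.1, u |: c.2) else (s, c.2)
  else c.

Definition dfs e := iter e dfs_step ([:: r], [set r]).

Arguments dfs : simpl never.

Variant dfs_step_spec W v s : seq N * {set N} -> option N -> Prop :=
| DfsPush u of edge v u & u \notin W : dfs_step_spec W v s (u :: v :: s, u |: W) (Some u)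
| DfsPop of (forall u, edge v u -> u \in W) : dfs_step_spec W v s (s, W) None.

Lemma dfs_stepP W v s : dfs_step_spec W v s (dfs_step (v :: s, W))
  (obind (onth (ports v) \o @nat_of_ord D) [pick j | fresh W v j]).
Proof.
rewrite /dfs_step /=; case: pickP => [j|no] /=.
  rewrite /fresh; case vu: onth => [u|] // uW; apply: DfsPush => //.
  by have /onth_ports[] := vu.
apply: DfsPop => u vu; apply: negbNE; apply/negP => uW.
have := no (Ordinal (port_lt degD vu)); rewrite /fresh.
have -> : onth (ports v) (Ordinal (port_lt degD vu)) = Some u by apply/onth_ports.
by rewrite uW.
Qed.

Lemma dfsS e : dfs e.+1 = dfs_step (dfs e). Proof. by []. Qed.

(** By the last clause, a visited node off the stack has only visited neighbours. Once the stack is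
    empty the visited set is thus closed under edges, and connectivity makes it everything. *)
Definition dfs_inv (c : seq N * {set N}) : Prop :=
  [/\ uniq c.1, {subset c.1 <= c.2}, r \in c.2 &
      forall x u, x \in c.2 -> x \notin c.1 -> edge x u -> u \in c.2].

Lemma dfs_invP e : dfs_inv (dfs e).
Proof.
elim: e => [|e]; first by split=> //= [x||x u]; rewrite !inE ?eqxx // => ->.
rewrite dfsS; case: (dfs e) => [[|v s] W] // [] /= us sW rW cl.
case: (dfs_stepP W v s) => [u vu uW|all_v]; split; rewrite //=.
- by rewrite us andbT; apply: contra uW; apply: sW.
- by move=> x; rewrite !inE => /orP[->//|/sW ->]; rewrite orbT.
- by rewrite inE rW orbT.
- move=> x y; rewrite !inE negb_or => /orP[/eqP->|xW]; first by rewrite eqxx.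
  by case/andP=> _ /(cl x y xW) h e1; rewrite h // orbT.
- by case/andP: us.
- by move=> x xs; apply: sW; rewrite inE xs orbT.
move=> x y xW xs; case: (eqVneq x v) => [->|xv]; first exact: all_v.
by apply: cl; rewrite // inE negb_or xv.
Qed.

(** A push removes one unvisited node, which counts twice, and lengthens the stack by one; a pop
    shortens the stack. Either way the first two terms lose one. *)
Lemma dfs_measure e : (dfs e).1 = [::] \/
  2 * (#|N| - #|(dfs e).2|) + size (dfs e).1 + e <= 2 * #|N|.
Proof.
elim: e => [|e IH].
  right; have : 0 < #|N| by apply/card_gt0P; exists r.
  by move: #|N| => n; rewrite /dfs /= cards1; lia.
case: IH => [s0|]; first by left; rewrite dfsS /dfs_step s0.
rewrite dfsS; case: (dfs e) => [[|v s] W]; first by left.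
case: (dfs_stepP W v s) => [u vu uW|_]; cbn [fst snd size] => IH; right; last lia.
have := max_card (mem (u |: W)); move: IH; rewrite cardsU1 uW; lia.
Qed.

Lemma dfs_stack_end e : 2 * #|N| <= e -> (dfs e).1 = [::].
Proof. by move=> ne; case: (dfs_measure e) => //; case: (dfs e).1 => // v s; cbn [size]; lia. Qed.

Lemma dfs_visited_end e : 2 * #|N| <= e -> (dfs e).2 = [set: N].
Proof.
move=> /dfs_stack_end se; have [_ _ rW cl] := dfs_invP e.
apply/setP => v; rewrite inE; have /connectP[p pp ->] := edge_conn r v.
elim: p (r) rW pp => [|w p IH] x xW //= /andP[xw]; apply: IH.
by apply: cl xW _ xw; rewrite se.
Qed.

(** The potential counts the unvisited neighbours of [v], plus one while [v] is unvisited or on the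
    stack. When [v] is on top, a push consumes such a neighbour and a pop consumes the extra one. *)
Lemma dfs_head_count v T : \sum_(e < T) (ohead (dfs e).1 == Some v) <= D.+1.
Proof.
pose pot (c : seq N * {set N}) :=
  #|[set u | edge v u & u \notin c.2]| + ((v \notin c.2) || (v \in c.1)).
suff H : \sum_(e < T) (ohead (dfs e).1 == Some v) + pot (dfs T) <= D.+1.
  by apply: leq_trans H; rewrite leq_addr.
elim: T => [|T IH].
  rewrite big_ord0 add0n -addn1 leq_add ?leq_b1 // (leq_trans _ (degD v)) //.
  by apply: subset_leq_card; apply/subsetP => u; rewrite !inE => /andP[].
rewrite big_ord_recr /=; apply: leq_trans IH; rewrite -addnA leq_add2l.
have [us sW _ _] := dfs_invP T; move: us sW; rewrite dfsS.
case: (dfs T) => [[|x s] W] //= /andP[xs us] sW.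
have xW : x \in W by apply: sW; rewrite inE eqxx.
case: (dfs_stepP W x s) => [u xu uW|_]; rewrite /pot /= !inE.
  have sub : [set w | edge v w & w \notin u |: W] \subset [set w | edge v w & w \notin W].
    by apply/subsetP => w; rewrite !inE negb_or => /andP[-> /andP[]].
  case: (eqVneq x v) => [xv|xv]; last first.
    rewrite (_ : (Some x == Some v) = false) ?add0n; last by apply/eqP => -[/eqP]; rewrite (negbTE xv).
    rewrite leq_add ?subset_leq_card //=.
    by case: (eqVneq v u) => [->|_] /=; rewrite ?uW // orbF.
  rewrite xv eqxx /= !orbT addnA leq_add2r add1n; apply: proper_card.
  rewrite properE sub; apply/subsetPn; exists u; rewrite !inE ?eqxx ?andbF //.
  by rewrite -xv xu.
case: (eqVneq x v) => [<-|xv].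
  by rewrite eqxx xW (negbTE xs) /= addn0 addnC.
rewrite (_ : (Some x == Some v) = false) ?add0n; last by apply/eqP => -[/eqP]; rewrite (negbTE xv).
exact: leqnn.
Qed.

End DFS.

Arguments dfs : simpl never.

(** * Evaluation of local formulas over addresses *)

Section Eval.
Variables (D k l : nat).

(** Equality is tested between an address of length at most [k] and either its like, one extended by
    an edge, or a concatenation of two of length at most [k]. *)
Definition radius := (k + k).+1.

Local Notation adr := (addr D radius).

Definition facts_t : finType := {set l.-tuple adr}.

Definition adr0 : adr := @Bseq radius _ [::] isT.

Variables (eqv : {set adr * adr}) (known : {ffun adr -> facts_t}).

Definition same (p q : seq ('I_D * 'I_D)) : bool :=
  if insub p is Some p' then if insub q is Some q' then (p', q') \in eqv else false
  else false.

(** Under [eqvP] an address that leads nowhere is related to nothing, so [same p p] tests that [p]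
    leads to a node. *)
Definition good (p : adr) : bool := (size p <= k) && same p p.

(** A tuple of [T] is stored at its first component. A [Rel] atom therefore consults the facts of
    the node named by the first argument, prefixing their addresses with the address of that
    node. *)
Fixpoint leval n (f : fo l.+1 n) : n.-tuple adr -> bool :=
  match f in fo _ n return n.-tuple adr -> bool with
  | Equ _ i j => fun s => same (tnth s i) (tnth s j)
  | Adj _ i j => fun s => [exists x, same (rcons (tnth s i) x) (tnth s j)]
  | Rel _ t => fun s => [exists q : l.-tuple adr,
      (q \in known (tnth s (thead t))) &&
      [forall m, same (tnth s (thead t) ++ tnth q m)
                      (tnth s (tnth t (lift ord0 m)))]]
  | Neg _ f => fun s => ~~ leval f s
  | And _ f g => fun s => leval f s && leval g s
  | Or _ f g => fun s => leval f s || leval g s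
  | Exi _ f => fun s => [exists p, good p && leval f [tuple of rcons s p]]
  | All _ f => fun s => [forall p, good p ==> leval f [tuple of rcons s p]]
  end.

Variables (N : network) (a : N) (T : {set l.+1.-tuple N}).
Hypothesis degD : forall u : N, degree u <= D.

Definition place (v : N) (p : adr) : N := odflt v (walk v p).

Definition reaches (v : N) (p : adr) : bool := (size p <= k) && (walk v p != None).

Definition facts_of (v : N) (X : {set l.+1.-tuple N}) : facts_t :=
  [set q : l.-tuple adr | all (reaches v) q &&
     ([tuple of v :: map (place v) q] \in X)].

Hypothesis eqvP : forall p q : adr,
  reflect (walk a p != None /\ walk a p = walk a q) ((p, q) \in eqv).
Hypothesis knownP : forall (p : adr) u, walk a p = Some u -> known p = facts_of u T.
Hypothesis T_local : forall t m, t \in T -> dist (@edge N) (thead t) (tnth t m) <= k.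

Lemma sameP p q : size p <= radius -> size q <= radius ->
  reflect (walk a p != None /\ walk a p = walk a q) (same p q).
Proof.
move=> sp sq; rewrite /same; case: insubP => [p' _ pE|]; last by rewrite sp.
by case: insubP => [q' _ qE|]; last (by rewrite sq); rewrite -pE -qE; apply: eqvP.
Qed.

Lemma size_adr (p : adr) : size p <= radius. Proof. exact: size_bseq. Qed.

Lemma goodE p : good p = reaches a p.
Proof.
rewrite /good /reaches; case: leqP => //= _; apply/sameP/idP; try exact: size_adr.
  by case.
by [].
Qed.

Lemma reaches_walk v p : reaches v p -> walk v p = Some (place v p).
Proof. by rewrite /place => /andP[_]; case: walk. Qed.

Lemma dist_reaches v u : dist (@edge N) v u <= k <-> exists2 p, reaches v p & place v p = u.
Proof.
split=> [/(dist_walk degD)[p sp wp]|[p rp <-]].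
  have sK : size p <= radius by rewrite /radius; lia.
  by exists (Bseq sK); rewrite /reaches /place /= ?sp wp.
by apply/(dist_walk degD); exists p; [case/andP: rp|exact: reaches_walk].
Qed.

Lemma tuple_choice (v : N) (y : l.-tuple N) :
  (forall m, dist (@edge N) v (tnth y m) <= k) ->
  exists2 q : l.-tuple adr, all (reaches v) q & [tuple of map (place v) q] = y.
Proof.
move=> H; have ex m : exists p, reaches v p && (place v p == tnth y m).
  by have /dist_reaches[p rp pE] := H m; exists p; rewrite rp pE eqxx.
exists [tuple xchoose (ex m) | m < l].
  apply/all_tnthP => m; rewrite tnth_mktuple.
  by case/andP: (xchooseP (ex m)).
apply: eq_from_tnth => m; rewrite tnth_map tnth_mktuple.
by case/andP: (xchooseP (ex m)) => _ /eqP.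
Qed.

Lemma tnth_rcons_wk n (U : Type) (s : n.-tuple U) w (x : 'I_n) :
  tnth [tuple of rcons s w] (wk x) = tnth s x.
Proof. by rewrite !(tnth_nth w) /= nth_rcons size_tuple ltn_ord. Qed.

Lemma tnth_rcons_max n (U : Type) (s : n.-tuple U) w :
  tnth [tuple of rcons s w] ord_max = w.
Proof. by rewrite (tnth_nth w) /= nth_rcons size_tuple ltnn eqxx. Qed.

(** Variable [x] denotes [a] itself, so relativized quantifiers range over [N^k(a)], whose nodes are
    exactly those named by good addresses. For [Rel], the locality of [T] provides addresses of
    length at most [k] from the head of a tuple to its other components. *)
Lemma levalP n (f : fo l.+1 n) (x : 'I_n) (s : n.-tuple adr) :
  all (reaches a) s -> place a (tnth s x) = a ->
  sat (@edge N) T (relativize k f x) [tuple of map (place a) s] = leval f s.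
Proof.
elim: n / f x s => /= [n i j|n i j|n t|n f IH|n f IHf g IHg|n f IHf g IHg|n f IH|n f IH] x s rs sx;
  have {}rs0 i0 : reaches a (tnth s i0) by [apply: (all_tnthP rs)].
- rewrite !tnth_map; have wi := reaches_walk (rs0 i); have wj := reaches_walk (rs0 j).
  apply/eqP/sameP; rewrite ?size_adr ?wi ?wj //; first by move=> ->.
  by case=> _ [].
- rewrite !tnth_map; have wi := reaches_walk (rs0 i); have wj := reaches_walk (rs0 j).
  have sz y : size (rcons (tnth s i) y) <= radius.
    by rewrite size_rcons ltnS (leq_trans _ (leq_addr _ _)) //; case/andP: (rs0 i).
  apply/idP/existsP => [/(walk_edge degD)[y wy]|[y]].
    exists y; apply/sameP; rewrite ?size_adr ?sz //.
    by rewrite -cats1 walk_cat wi wj [obind _ _]wy.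
  case/sameP; rewrite ?size_adr ?sz // => _.
  by rewrite -cats1 walk_cat wi wj => wy; apply/(walk_edge degD); exists y.
- set p0 := tnth s (thead t).
  have wp0 := reaches_walk (rs0 (thead t)).
  have sz (q : l.-tuple adr) m : all (reaches (place a p0)) q -> size (p0 ++ tnth q m) <= radius.
    move=> /all_tnthP/(_ m)/andP[sq _]; rewrite size_cat /radius.
    have s0 : size p0 <= k by case/andP: (rs0 (thead t)).
    by rewrite ltnW // ltnS leq_add.
  set y := [tuple of _].
  have y0 : thead y = place a p0 by rewrite /y /thead !tnth_map.
  have yS m : tnth y (lift ord0 m) = place a (tnth s (tnth t (lift ord0 m))).
    by rewrite /y !tnth_map.
  rewrite (knownP wp0); apply/idP/existsP => [yT|[q /andP[]]].
    have [|q rq qE] := @tuple_choice (place a p0) [tuple tnth y (lift ord0 m) | m < l].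
      by move=> m; rewrite tnth_mktuple -y0; apply: T_local.
    have qm m : place (place a p0) (tnth q m) = tnth y (lift ord0 m).
      by have := congr1 (@tnth _ _ ^~ m) qE; rewrite tnth_map tnth_mktuple.
    exists q; rewrite inE rq /=; apply/andP; split.
      suff -> : [tuple of place a p0 :: [seq place (place a p0) i | i <- q]] = y by [].
      apply: eq_from_tnth => m; case: (unliftP ord0 m) => [m'|] -> {m}.
        by rewrite tnthS tnth_map qm.
      by rewrite tnth0 -y0.
    apply/forallP => m; apply/sameP; rewrite ?size_adr ?sz //.
    rewrite walk_cat wp0 /= reaches_walk; last exact: (all_tnthP rq).
    by split=> //; rewrite qm yS -reaches_walk.
  rewrite inE => /andP[rq qT] /forallP H.
  suff -> : y = [tuple of place a p0 :: [seq place (place a p0) i | i <- q]] by [].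
  apply: eq_from_tnth => m; case: (unliftP ord0 m) => [m'|] -> {m}.
    rewrite yS tnthS tnth_map; have /sameP := H m'.
    rewrite ?size_adr ?sz // => -[] // _; rewrite walk_cat wp0 /=.
    by rewrite !reaches_walk // => [[]//|]; exact: (all_tnthP rq).
  by rewrite -[LHS]/(thead y) y0 tnth0.
- by rewrite IH.
- by rewrite IHf // IHg.
- by rewrite IHf // IHg.
- have ext p : [tuple of rcons [tuple of map (place a) s] (place a p)]
     = [tuple of map (place a) [tuple of rcons s p]] by apply: val_inj; rewrite /= map_rcons.
  have conn : forall u v : N, connect (@edge N) u v by exact: edge_conn.
  apply/existsP/existsP => [[v /andP[]]|[p /andP[gp lp]]].
    rewrite sat_near // tnth_rcons_wk tnth_rcons_max tnth_map sx.
    case/dist_reaches=> p rp <-; rewrite ext IH //=; last by rewrite tnth_rcons_wk.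
      by move=> H; exists p; rewrite goodE rp.
    by rewrite all_rcons rp.
  exists (place a p); rewrite sat_near // tnth_rcons_wk tnth_rcons_max tnth_map sx.
  rewrite goodE in gp; rewrite ext IH //=; last by rewrite tnth_rcons_wk.
    by rewrite lp andbT; apply/dist_reaches; exists p.
  by rewrite all_rcons gp.
- have ext p : [tuple of rcons [tuple of map (place a) s] (place a p)]
     = [tuple of map (place a) [tuple of rcons s p]] by apply: val_inj; rewrite /= map_rcons.
  have conn : forall u v : N, connect (@edge N) u v by exact: edge_conn.
  apply/forallP/forallP => [H p|H v].
    apply/implyP; rewrite goodE => rp; have := H (place a p).
    rewrite sat_near // tnth_rcons_wk tnth_rcons_max tnth_map sx ext IH /=.
    - by case/orP=> // /negP[]; apply/dist_reaches; exists p.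
    - by rewrite all_rcons rp.
    - by rewrite tnth_rcons_wk.
  rewrite sat_near // tnth_rcons_wk tnth_rcons_max tnth_map sx.
  rewrite -implybE; apply/implyP => /dist_reaches[p rp <-].
  rewrite ext IH /=; first by have /implyP := H p; rewrite goodE; apply.
    by rewrite all_rcons rp.
  by rewrite tnth_rcons_wk.
Qed.

End Eval.

Lemma sat_localize (N : network) r (k l : nat) (T : {set r.-tuple N}) (f : fo r l.+1) s :
  sat (@edge N) T (localize k f) s =
  [forall m, dist (@edge N) (thead s) (tnth s (lift ord0 m)) <= k] &&
  sat (@edge N) T (relativize k f ord0) s.
Proof.
rewrite /localize.
have -> : [forall m, dist (@edge N) (thead s) (tnth s (lift ord0 m)) <= k] =
  all (fun m => dist (@edge N) (thead s) (tnth s (lift ord0 m)) <= k) (enum 'I_l).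
  apply/forallP/allP => [H m _|H m]; first exact: H.
  by apply: H; rewrite mem_enum.
elim: (enum _) => //= m e IH; rewrite IH sat_near; last exact: edge_conn.
by rewrite andbA.
Qed.

Lemma localP (N : network) r (k l : nat) (T : {set r.-tuple N}) (f : fo r l.+1) s m :
  sat (@edge N) T (localize k f) s -> dist (@edge N) (thead s) (tnth s m) <= k.
Proof.
rewrite sat_localize => /andP[/forallP H _].
by case: (unliftP ord0 m) => [m'|] ->; [exact: H|rewrite dist_root].
Qed.

(** * Stages of a local fixpoint *)

Section Stages.
Variables (D k l : nat) (N : network) (phi : fo l.+1 l.+1).
Hypothesis degD : forall u : N, degree u <= D.

Local Notation St := (stage (@edge N) (localize k phi)).
Local Notation adr := (addr D (radius k)).

Lemma stage_mono i j : i <= j -> St i \subset St j.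
Proof.
move=> /subnK <-; elim: (j - i) => // m IH.
by rewrite addSn /= (subset_trans IH) // subsetUr.
Qed.

Lemma stage_local i t m : t \in St i -> dist (@edge N) (thead t) (tnth t m) <= k.
Proof.
elim: i => [|i IH] /=; first by rewrite inE.
by rewrite inE => /orP[|//]; rewrite inE; apply: localP.
Qed.

Lemma stage_facts i (t : l.+1.-tuple N) : t \in St i ->
  exists2 q : l.-tuple adr, all (reaches (thead t)) q &
    t = [tuple of thead t :: map (place (thead t)) q].
Proof.
move=> tS; have [|q rq qE] := @tuple_choice D k l N degD (thead t) [tuple of behead t].
  by move=> m; rewrite tnth_behead; apply: (stage_local _ tS).
exists q => //; rewrite {1}(tuple_eta t); apply: val_inj => /=; congr cons.
by rewrite -[RHS]/(val [tuple of map (place (thead t)) q]) qE.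
Qed.

(** By locality a tuple is determined by its head and one of boundedly many address tuples, which
    makes the number of tuples linear in [n]. *)
Lemma card_stage i : #|St i| <= #|N| * #|{: l.-tuple adr}|.
Proof.
rewrite -card_prod; pose h (x : N * l.-tuple adr) := [tuple of x.1 :: map (place x.1) x.2].
apply: leq_trans (_ : #|h @: setT| <= _); last by rewrite (leq_trans (leq_imset_card _ _)) // cardsT.
apply: subset_leq_card; apply/subsetP => t /stage_facts[q _ tE].
by apply/imsetP; exists (thead t, q).
Qed.

(** If no stage up to [i] equalled its successor, each would add a tuple, and stage [i.+1] would
    exceed the bound of [card_stage]. *)
Lemma stage_stable i j : #|N| * #|{: l.-tuple adr}| <= i -> i <= j -> St j = St i.
Proof.
move=> bi ij.
have fix_stable m m' : St m.+1 = St m -> m <= m' -> St m' = St m.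
  move=> mE /subnK <-; elim: (m' - m) => // d IH.
  by rewrite addSn -[LHS]/([set s | sat _ (St (d + m)) _ s] :|: St (d + m)) IH.
have [m mi mE] : exists2 m, m <= i & St m.+1 = St m.
  have [/existsP[m /eqP mE]|no] := boolP [exists m : 'I_i.+1, St m.+1 == St m].
    by exists m => //; rewrite -ltnS.
  have grow m : m <= i.+1 -> m <= #|St m|.
    elim: m => [|m IH] lt //; apply: leq_ltn_trans (IH (ltnW lt)) _.
    apply: proper_card; rewrite properEneq stage_mono // andbT eq_sym.
    by move: no; rewrite negb_exists => /forallP/(_ (Ordinal lt)).
  by have := leq_trans (grow _ (leqnn _)) (card_stage _); rewrite ltnNge bi.
by rewrite (fix_stable _ _ mE mi) (fix_stable _ _ mE) // (leq_trans mi).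
Qed.

Lemma in_mu_stage i t : #|N| * #|{: l.-tuple adr}| <= i ->
  in_mu (@edge N) (localize k phi) t <-> t \in St i.
Proof.
move=> bi; split=> [[j tj]|]; last by exists i.
have [ij|ji] := leqP i j; first by rewrite -(stage_stable bi ij).
by apply: (subsetP (stage_mono (ltnW ji))).
Qed.

Definition local_facts (v : N) i : facts_t D k l := facts_of D k v (St i).

Lemma local_facts_mono v i j : i <= j -> local_facts v i \subset local_facts v j.
Proof.
move=> ij; apply/subsetP => q; rewrite !inE => /andP[-> h] /=.
exact: (subsetP (stage_mono ij)).
Qed.

(** Each change adds a fact. As [0.-1 = 0], stage 0 counts as unchanged. *)
Lemma local_facts_changes v T :
  \sum_(i < T) (local_facts v i != local_facts v i.-1) <= #|{: l.-tuple adr}|.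
Proof.
case: T => [|T]; first by rewrite big_ord0.
apply: leq_trans (_ : #|local_facts v T| <= _); last exact: max_card.
elim: T => [|T IH]; first by rewrite big_ord_recr big_ord0 /= eqxx.
rewrite big_ord_recr /=; case: eqVneq => [->|ne]; first by rewrite addn0.
rewrite addn1 (leq_ltn_trans IH) //; apply: proper_card.
by rewrite properEneq eq_sym ne local_facts_mono.
Qed.

Lemma local_facts_step v i (eqv : {set adr * adr}) (known : {ffun adr -> facts_t D k l}) :
  (forall p q : adr, reflect (walk v p != None /\ walk v p = walk v q) ((p, q) \in eqv)) ->
  (forall (p : adr) u, walk v p = Some u -> known p = local_facts u i) ->
  local_facts v i :|: [set t : l.-tuple adr | all (good eqv) t &&
     leval eqv known phi [tuple of adr0 D k :: t]] = local_facts v i.+1.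
Proof.
move=> eqvP knownP; apply/setP => t; rewrite !inE (eq_all (goodE eqvP)).
case rt: (all _ t) => //=; rewrite orbC; congr orb.
rewrite sat_localize.
rewrite -(@levalP D k l eqv known N v (St i) degD eqvP knownP (@stage_local i)
  _ phi ord0 [tuple of adr0 D k :: t]) //.
have -> : [tuple of map (place v) [tuple of adr0 D k :: t]] = [tuple of v :: map (place v) t].
  exact: val_inj.
(* The distance conditions added by [localize] hold because every component is named by a good
   address. *)
suff -> : [forall m, dist (@edge N) (thead [tuple of v :: map (place v) t])
   (tnth [tuple of v :: map (place v) t] (lift ord0 m)) <= k] by [].
apply/forallP => m; rewrite tnthS tnth_map; apply/(dist_reaches k degD).
by exists (tnth t m) => //; apply: (all_tnthP rt).
Qed.

End Stages.

(** * The algorithm *)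

Section Algorithm.
Variables (D k l : nat) (phi : fo l.+1 l.+1).

Local Notation adr := (addr D (radius k)).
Local Notation facts := (facts_t D k l).
Local Notation load_t := (option 'I_D + facts)%type.
Local Notation view_t := {ffun adr -> option load_t}.

(* Pairs of addresses known to lead to the same node, ports known to lead to visited nodes,
   existing ports, whether this node is visited, its parent port, whether it has the token. *)
Definition naming : finType :=
  ({set adr * adr} * {set 'I_D} * {ffun 'I_D -> bool} * bool * option 'I_D * bool)%type.

(* Facts known for the node at each address, own facts, whether these have just changed. *)
Definition fixing : finType := ({ffun adr -> facts} * facts * bool)%type.

Definition eqv_of (n : naming) := let: (e, _, _, _, _, _) := n in e.
Definition seen_of (n : naming) := let: (_, w, _, _, _, _) := n in w.
Definition ports_of (n : naming) := let: (_, _, P, _, _, _) := n in P.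
Definition mark_of (n : naming) := let: (_, _, _, m, _, _) := n in m.
Definition parent_of (n : naming) := let: (_, _, _, _, p, _) := n in p.
Definition token_of (n : naming) := let: (_, _, _, _, _, h) := n in h.

Definition target (n : naming) : option 'I_D :=
  if [pick j | ports_of n j && (j \notin seen_of n)] is Some j then Some j
  else parent_of n.

Definition load_of (s : naming * fixing) : option load_t :=
  if token_of s.1 then Some (inl (target s.1))
  else if s.2.2 then Some (inr s.2.1.2) else None.

Definition at_ (w : view_t) (p : seq ('I_D * 'I_D)) : option load_t := obind w (insub p).

(** Only the token holder floods in this phase, so all addresses in [heard] lead to it. In an
    address step [x], [x.2] is the holder's port on the edge: hearing it as target means receiving
    the token. A marked node gets the token back by backtracking and keeps its parent. *)
Definition name_upd (n : naming) (w : view_t) : naming :=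
  let: (e, seen, P, mark, par, _) := n in
  let heard := [set p | w p != None] in
  let e' := e :|: setX heard heard in
  let seen' := seen :|: [set j | [exists i, at_ w [:: (j, i)] != None]] in
  if [pick x | at_ w [:: x] == Some (inl (Some x.2))] is Some x
  then (e', seen', P, true, if mark then par else Some x.1, true)
  else (e', seen', P, mark, par, false).

(** Silence at an address that leads to a node means that the facts there have not changed, so the
    stored copy stays valid. *)
Definition fix_upd (e : {set adr * adr}) (x : fixing) (w : view_t) : fixing :=
  let: (kn, fc, _) := x in
  let kn' : {ffun adr -> facts} := [ffun p => if w p is Some (inr F) then F else kn p] in
  let fc' := fc :|: [set t : l.-tuple adr | all (good e) t &&
                       leval e kn' phi [tuple of adr0 D k :: t]] in
  (kn', fc', fc' != fc).

Definition encode (F : facts) : seq bool :=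
  enc_seq (enc_seq (enc_seq enc_nat))
    [seq [seq [seq nat_of_ord x.1 | x <- val p] | p <- val t] | t <- enum F].

Definition fixpoint_alg : falg D (radius k) :=
  @FAlg D (radius k) load_t (naming * fixing)%type
    (fun b P => ((set0, set0, P, b, None, b), ([ffun=> set0], set0, false)))
    load_of
    (fun s ph w => if ph then (s.1, fix_upd (eqv_of s.1) s.2 w) else (name_upd s.1 w, s.2))
    (fun s => encode s.2.1.2).

Variables (N : network) (r : N).
Hypothesis degD : forall u : N, degree u <= D.

Definition parent_node (S : N -> naming) v : option N :=
  obind (fun j : 'I_D => onth (ports v) j) (parent_of (S v)).

(** The stack of the search is kept as a linked list of parent ports that ends at a node without
    parent. *)
Definition parent_chain (S : N -> naming) (s : seq N) : bool :=
  if s is x :: s' then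
    path (fun x y => parent_node S x == Some y) x s' && (parent_of (S (last x s')) == None)
  else true.

(** The condition [ohead c.1 != Some u] exempts the current holder, whose visit becomes known only
    through the flooding of the coming epoch. *)
Record naming_inv (c : seq N * {set N}) (S : N -> naming) : Prop := NamingInv {
  inv_ports : forall v, ports_of (S v) = [ffun p : 'I_D => p < size (ports v)];
  inv_mark : forall v, mark_of (S v) = (v \in c.2);
  inv_token : forall v, token_of (S v) = (ohead c.1 == Some v);
  inv_seen : forall v (j : 'I_D) u, onth (ports v) j = Some u -> ohead c.1 != Some u ->
    (j \in seen_of (S v)) = (u \in c.2);
  inv_chain : parent_chain S c.1;
  inv_eqv_sound : forall v p q, (p, q) \in eqv_of (S v) ->
    walk v p != None /\ walk v p = walk v q;
  inv_eqv_complete : forall v (p q : adr) u, u \in c.2 -> ohead c.1 != Some u ->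
    walk v p = Some u -> walk v q = Some u -> (p, q) \in eqv_of (S v)
}.

Lemma naming_inv0 : naming_inv ([:: r], [set r])
  (fun v => (fini fixpoint_alg (v == r) [ffun p : 'I_D => p < size (ports v)]).1).
Proof.
split=> //= [v|v|v j u _|v p q|v p q u]; rewrite ?inE //.
- by rewrite eq_sym; apply/eqP/eqP => [->|[->]].
- by rewrite eq_sym => ne; apply/esym/negbTE; apply: contra ne => /eqP->.
by move=> /eqP ->; rewrite eqxx.
Qed.

Lemma at_view (S : N -> fstate fixpoint_alg) v x :
  at_ (view S v) [:: x] = obind (fun u => load_of (S u)) (walk v [:: x]).
Proof.
rewrite /at_; have sx : size [:: x] <= radius k by [].
by rewrite insubT /= ffunE.
Qed.

(** * One epoch of the naming phase *)

Section NameStep.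
Variables (c : seq N * {set N}) (S : N -> fstate fixpoint_alg).
Hypothesis inv : naming_inv c (fun v => (S v).1).
Hypothesis no_fix : forall v, (S v).2.2 = false.

Lemma load_naming v : load_of (S v) =
  if ohead c.1 == Some v then Some (inl (target (S v).1)) else None.
Proof. by rewrite /load_of (inv_token inv) no_fix. Qed.

Lemma naming_inv_idle : c.1 = [::] ->
  naming_inv (dfs_step D c) (fun v => name_upd (S v).1 (view S v)).
Proof.
move=> c0; have -> : dfs_step D c = c by rewrite /dfs_step c0.
have wN v p : view S v p = None.
  by rewrite ffunE; case: walk => //= u; rewrite load_naming c0.
suff E v : name_upd (S v).1 (view S v) = (S v).1.
  case: inv => h1 h2 h3 h4 h5 h6 h7; split=> [v|v|v|v j u|||]; rewrite ?E //.
  - exact: h4.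
  - by rewrite c0.
  - by move=> v p q; rewrite E; apply: h6.
  - by move=> v p q u; rewrite E; apply: h7.
have := inv_token inv v; rewrite c0 /name_upd.
case: (S v).1 => [[[[[e seen] P] mark] par] tok] /= ->.
have aN x : at_ (view S v) x = None by rewrite /at_; case: insub => //= p; rewrite wN.
case: pickP => [x|_]; first by rewrite aN.
congr (_, _, _, _, _, _); apply/setP => x; rewrite !inE.
  by rewrite wN /= orbF.
by rewrite (_ : [exists i, _] = false) ?orbF //; apply/existsP => -[i]; rewrite aN.
Qed.

Variables (x : N) (s : seq N).
Hypothesis cE : c.1 = x :: s.
Hypothesis cW : {subset c.1 <= c.2}.

Definition next_holder : option N :=
  obind (fun j : 'I_D => onth (ports x) j) (target (S x).1).

(** The holder's local choice agrees with the central search: its unseen ports are exactly the fresh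
    ones, as no port leads back to itself, and its parent is the next node on the stack. *)
Lemma next_holderE : ohead (dfs_step D c).1 = next_holder.
Proof.
rewrite /next_holder /target /dfs_step cE.
rewrite (_ : [pick j | ports_of (S x).1 j && (j \notin seen_of (S x).1)] =
  [pick j | fresh c.2 x j]); last first.
  apply: eq_pick => j; rewrite (inv_ports inv) ffunE /fresh -onthTE.
  case xj: onth => [u|] //=; rewrite (inv_seen inv xj) // cE /=.
  apply/eqP => -[xu]; have /onth_ports[] := xj.
  by rewrite xu edge_irr.
case: pickP => [j|_] /=.
  by rewrite /fresh; case: onth.
have := inv_chain inv; rewrite cE /parent_chain /parent_node.
by case: s => [|y s'] /=; [move/eqP=> ->|case/andP=> /andP[/eqP ->]].
Qed.

Lemma visited_next u : (u \in (dfs_step D c).2) = (u \in c.2) || (next_holder == Some u).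
Proof.
rewrite -next_holderE /dfs_step cE; case: (obind _ _) => [w|] /=.
  by rewrite !inE orbC; congr orb; rewrite eq_sym; apply/eqP/eqP => [->|[->]].
rewrite orbC; case: eqP => //= h; rewrite cW // cE.
by case: (s) h => //= y s' [->]; rewrite !inE eqxx orbT.
Qed.

Lemma view_naming v p : view S v p =
  if walk v p == Some x then Some (inl (target (S x).1)) else None.
Proof.
rewrite ffunE; case wE: walk => [u|] //=; rewrite load_naming cE /=.
by rewrite eq_sym; case: eqP => // -[->].
Qed.

Lemma at_naming v y : at_ (view S v) [:: y] =
  if walk v [:: y] == Some x then Some (inl (target (S x).1)) else None.
Proof.
rewrite at_view; case wE: walk => [u|] //=; rewrite load_naming cE /=.
by rewrite eq_sym; case: eqP => // -[->].
Qed.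

Variant token_spec v : option ('I_D * 'I_D) -> bool -> Prop :=
| GetsToken (y : 'I_D * 'I_D) of onth (ports v) y.1 = Some x : token_spec v (Some y) true
| NoToken : token_spec v None false.

Lemma tokenP v : token_spec v
  [pick y | at_ (view S v) [:: y] == Some (inl (Some y.2))] (next_holder == Some v).
Proof.
have key y : (at_ (view S v) [:: y] == Some (inl (Some y.2))) =
   (walk v [:: y] == Some x) && (target (S x).1 == Some y.2).
  by rewrite at_naming; case: (_ == Some x) => //=; apply/eqP/eqP => [[->]|->].
case: pickP => [y|no].
  rewrite key => /andP[/eqP]; case: y => j i /walk1[vj iE] /eqP tE.
  have -> : next_holder == Some v; last by constructor.
  rewrite /next_holder tE /=; apply/eqP/onth_ports; split=> //.
  by have /onth_ports[e _] := vj; rewrite edge_sym.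
have -> : (next_holder == Some v) = false; last by constructor.
apply/eqP; rewrite /next_holder; case tE: target => [i|] //= /onth_ports[xv iE].
have vx : edge v x by rewrite edge_sym.
have := no (Ordinal (port_lt degD vx), i); rewrite key tE eqxx andbT => /eqP[].
by apply/walk1; split=> //; apply/onth_ports.
Qed.

(** The new parent port is left existential, since only the node behind it matters. *)
Lemma name_updE v : exists y : option 'I_D, name_upd (S v).1 (view S v) =
   (eqv_of (S v).1 :|: setX [set p : adr | walk v p == Some x] [set p : adr | walk v p == Some x],
    seen_of (S v).1 :|: [set j : 'I_D | [exists i : 'I_D, walk v [:: (j, i)] == Some x]],
    ports_of (S v).1, mark_of (S v).1 || (next_holder == Some v),
    (if ~~ mark_of (S v).1 && (next_holder == Some v) then y else parent_of (S v).1),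
    next_holder == Some v) /\
   (next_holder == Some v -> obind (fun j : 'I_D => onth (ports v) j) y = Some x).
Proof.
have vE p : (view S v p != None) = (walk v p == Some x) by rewrite view_naming; case: ifP.
have sE : [set p | view S v p != None] = [set p : adr | walk v p == Some x].
  by apply/setP => p; rewrite !inE vE.
have jE : [set j : 'I_D | [exists i : 'I_D, at_ (view S v) [:: (j, i)] != None]] =
          [set j : 'I_D | [exists i : 'I_D, walk v [:: (j, i)] == Some x]].
  by apply/setP => j; rewrite !inE; apply: eq_existsb => i; rewrite at_naming; case: ifP.
rewrite /name_upd; case: (S v).1 => [[[[[e seen] P] mark] par] tok] /=.
rewrite sE jE; case: tokenP => [y yE|]; last by exists None; rewrite orbF andbF.
by exists (Some y.1); rewrite orbT andbT; case: mark.
Qed.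

(** The flooding adds precisely the holder [x] to what all nodes know. Parents of visited nodes
    never change, so the chain survives; a push prepends a node whose parent is [x]. *)
Lemma naming_inv_token : naming_inv (dfs_step D c) (fun v => name_upd (S v).1 (view S v)).
Proof.
have xW : x \in c.2 by rewrite cW // cE inE eqxx.
have keep v : v \in c.2 -> parent_of (name_upd (S v).1 (view S v)) = parent_of (S v).1.
  by have [y [-> _]] := name_updE v; rewrite /= (inv_mark inv) => ->.
have keep_chain t : {subset t <= c.2} ->
    parent_chain (fun v => name_upd (S v).1 (view S v)) t = parent_chain (fun v => (S v).1) t.
  case: t => //= y t tW; rewrite keep; last by apply: tW; apply: mem_last.
  congr andb; apply: (eq_in_path (P := mem c.2)); last by apply/allP => z /tW.
  by move=> z z' zW _ /=; rewrite /parent_node keep.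
split=> [v|v|v|v j u vj|||].
- by have [y [-> _]] := name_updE v; rewrite /= (inv_ports inv).
- by have [y [-> _]] := name_updE v; rewrite /= (inv_mark inv) visited_next.
- by have [y [-> _]] := name_updE v; rewrite /= next_holderE.
- rewrite next_holderE visited_next => /negbTE ->; rewrite orbF.
  have [y [-> _]] := name_updE v; rewrite /= !inE.
  have -> : [exists i : 'I_D, walk v [:: (j, i)] == Some x] = (u == x).
    apply/existsP/eqP => [[i /eqP/walk1[]]|ux]; first by rewrite vj => -[].
    have /onth_ports[vu _] := vj; have uv : edge u v by rewrite edge_sym.
    exists (Ordinal (port_lt degD uv)); apply/eqP/walk1.
    by rewrite vj -ux.
  case: eqVneq => [->|ux]; first by rewrite orbT xW.
  rewrite orbF; apply: (inv_seen inv vj); rewrite cE /=.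
  by apply: contra ux => /eqP[->].
- have chain := inv_chain inv; rewrite cE in chain.
  have nhE := next_holderE; have cD : c = (x :: s, c.2) by case: (c) cE => ? ? /= ->.
  have sub (t : seq N) : {subset t <= x :: s} -> {subset t <= c.2}.
    by move=> h z /h zs; rewrite cW // cE.
  move: nhE; rewrite cD; case: (dfs_stepP degD c.2 x s) => [w xw wW|_] nhE.
    have nw : next_holder == Some w by rewrite -nhE.
    have [y [E1 E2]] := name_updE w.
    have Kx := keep_chain (x :: s) (sub _ (fun z h => h)).
    rewrite chain /= in Kx.
    rewrite /= {1}/parent_node E1 /= (inv_mark inv) wW nw /= E2 // eqxx /=.
    exact: Kx.
  rewrite keep_chain; last by apply: sub => z zs; rewrite inE zs orbT.
  by move: chain; rewrite /=; case: (s) => //= y s' /andP[/andP[_ ->] ->].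
- move=> v p q; have [y [-> _]] := name_updE v; rewrite /= !inE.
  by case/orP=> [/(inv_eqv_sound inv)//|/andP[/eqP-> /eqP->]].
- move=> v p q u; rewrite visited_next next_holderE => + /negbTE nu; rewrite nu orbF => uW wp wq.
  have [y [-> _]] := name_updE v; rewrite /= !inE wp wq.
  case: (eqVneq u x) => [->|ux]; first by rewrite !eqxx orbT.
  rewrite (inv_eqv_complete inv uW _ wp wq) // cE /=.
  by apply: contra ux => /eqP[->].
Qed.

End NameStep.

(** * The fixpoint phase *)

Local Notation LF := (local_facts D k phi).

(** Knowledge about the nodes at all addresses lags one stage behind a node's own facts, since a
    change made in one epoch is flooded in the next. *)
Definition fix_inv i (X : N -> fstate fixpoint_alg) v : Prop :=
  [/\ token_of (X v).1 = false,
      forall p q : adr, (p, q) \in eqv_of (X v).1 <-> walk v p != None /\ walk v p = walk v q,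
      forall (p : adr) u, walk v p = Some u -> (X v).2.1.1 p = LF u i.-1,
      (X v).2.1.2 = LF v i & (X v).2.2 = (LF v i != LF v i.-1)].

Lemma fix_inv_step i (X : N -> fstate fixpoint_alg) : (forall v, fix_inv i X v) ->
  forall v, fix_inv i.+1 (fun v => upd (X v) true (view X v)) v.
Proof.
move=> inv v; have [tok eqvP kn fc ch] := inv v.
rewrite /fix_inv /= /fix_upd; case E: (X v).2 => [[kn0 fc0] ch0] /=.
rewrite E /= in kn fc ch.
set kn' := finfun _.
have knE (p : adr) u : walk v p = Some u -> kn' p = LF u i.
  move=> wp; have [tu _ _ fu cu] := inv u.
  rewrite !ffunE wp /= /load_of tu cu fu (kn _ _ wp).
  by case: eqP => //= ->.
have step := local_facts_step degD (fun p q => equivP idP (eqvP p q)) knE.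
by rewrite fc step.
Qed.

Variable e1 : nat.
Hypothesis e1_big : 2 * #|N| <= e1.

Local Notation S := (fexec fixpoint_alg r (leq e1)).

Lemma naming_phase e : e <= e1 -> naming_inv (dfs D r e) (fun v => (S e v).1) /\
  forall v, (S e v).2 = ([ffun=> set0], set0, false).
Proof.
elim: e => [_|e IH lt]; first by split=> //; exact: naming_inv0.
have [inv fx] := IH (ltnW lt); split; last by rewrite /= leqNgt lt.
have no_fix v : (S e v).2.2 = false by rewrite fx.
have [_ cW _ _] := dfs_invP r degD e; rewrite dfsS /= leqNgt lt /=.
case cE: (dfs D r e).1 => [|x s]; first exact: naming_inv_idle.
exact: naming_inv_token cE cW.
Qed.

Lemma fix_phase i v : fix_inv i (S (e1 + i)) v.
Proof.
elim: i v => [|i IH] v.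
  have [inv fx] := naming_phase (leqnn e1); rewrite addn0.
  have d1 := dfs_stack_end r degD e1_big; have d2 := dfs_visited_end r degD e1_big.
  have LF0 u : LF u 0 = set0.
    by apply/setP => q; rewrite !inE andbF.
  split; rewrite ?fx ?LF0 ?eqxx //=.
  - by rewrite (inv_token inv) d1.
  - move=> p q; split; first exact: (inv_eqv_sound inv).
    case; case wp: (walk v p) => [u|] // _ wq.
    by apply: (inv_eqv_complete inv (u := u)); rewrite ?d1 ?d2 ?inE.
  - by move=> p u _; rewrite ffunE LF0.
have := fix_inv_step IH v; rewrite addnS /fix_inv /=.
by rewrite leq_addr.
Qed.

(** Before [e1] a node broadcasts only while it holds the token, afterwards only when its facts have
    changed. *)
Lemma payload_count v T : \sum_(e < T) (pay (S e v) != None) <= D.+1 + #|{: l.-tuple adr}|.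
Proof.
pose g i : nat := LF v i != LF v i.-1.
apply: leq_trans (_ : \sum_(e < T) ((ohead (dfs D r e).1 == Some v) +
   (if e1 <= e then g (e - e1) else 0)) <= _).
  apply: leq_sum => e _; rewrite /= /load_of; case: (leqP e1 e) => [le|lt].
    rewrite -{1 2 3 4 5}(subnKC le); have [-> _ _ _ ->] := fix_phase (e - e1) v.
    by rewrite /g; case: (LF v (e - e1) == _); rewrite ?addn1.
  have [inv fx] := naming_phase (ltnW lt).
  by rewrite (inv_token inv) fx addn0; case: (ohead _ == Some v).
rewrite big_split leq_add //=; first exact: dfs_head_count.
apply: leq_trans (sum_shift g e1 T) _; exact: local_facts_changes.
Qed.

Lemma follow_facts (v : N) (q : l.-tuple adr) : all (reaches v) q ->
  [seq follow v p | p <- [seq [seq nat_of_ord x.1 | x <- val p] | p <- val q]] =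
  [seq Some (place v p) | p <- q].
Proof.
move=> /allP rq; rewrite -map_comp; apply/eq_in_map => p /rq rp.
exact/follow_walk/reaches_walk.
Qed.

Lemma final_stores e v (c : seq bool) : e1 + #|N| * #|{: l.-tuple adr}| <= e ->
  c = fres (S e v) ->
  exists Q : seq (seq (seq nat)),
    [/\ c = enc_seq (enc_seq (enc_seq enc_nat)) Q,
        forall t, t \in Q -> exists b : l.-tuple N,
          [seq follow v p | p <- t] = [seq Some x | x <- b] &
        forall b : l.-tuple N,
          in_mu (@edge N) (localize k phi) [tuple of v :: b] <->
          [seq Some x | x <- b] \in [seq [seq follow v p | p <- t] | t <- Q]].
Proof.
move=> le ->; have le1 : e1 <= e by apply: leq_trans le; rewrite leq_addr.
have [_ _ _ fE _] := fix_phase (e - e1) v; rewrite subnKC // in fE.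
have iE : #|N| * #|{: l.-tuple adr}| <= e - e1 by rewrite leq_subRL.
rewrite /= /encode fE; set i := e - e1 in iE *.
set Q := [seq _ | t <- _]; exists Q; split=> //.
  move=> t /mapP[q]; rewrite mem_enum inE => /andP[rq _] ->.
  by exists [tuple of map (place v) q]; rewrite follow_facts // -map_comp.
move=> b; have muE := in_mu_stage phi degD [tuple of v :: b] iE; split=> [/muE tS|].
  have [q rq tE] := stage_facts degD tS.
  have bE : val b = map (place v) q by have := congr1 (fun t => behead (val t)) tE.
  apply/mapP; exists [seq [seq nat_of_ord x.1 | x <- val p] | p <- val q].
    apply/mapP; exists q => //; rewrite mem_enum inE rq.
    by move: tS; rewrite {1}tE.
  by rewrite follow_facts // bE -map_comp.
move=> /mapP[t /mapP[q]]; rewrite mem_enum inE => /andP[rq qS] -> {t}.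
rewrite follow_facts // => E.
have Si : injective (@Some N) by move=> y z [].
have bE : val b = map (place v) q by apply: (inj_map Si); rewrite -map_comp.
apply/muE; suff -> : [tuple of v :: b] = [tuple of v :: map (place v) q] by [].
by apply: val_inj; rewrite /= bE.
Qed.

End Algorithm.

Theorem theorem9 (D k l : nat) (phi : fo l.+1 l.+1) :
  exists (M : machine D) (c : nat),
    forall (N : network) (r : N),
      (forall u : N, degree u <= D) ->
      exists R : run M r,
        [/\ (forall a : N,
               stores (conf R (rounds R) a) a
                 (fun b : l.-tuple N =>
                    in_mu (@edge N) (localize k phi) [tuple of a :: b])),
            in_time_per_round R <= c,
            dist_time R <= c * #|N|,
            msg_size R <= c
          & msg_per_node R <= c].
Proof.
pose B := #|{: l.-tuple (addr D (radius k))}|.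
(* The search needs [2 * n] epochs and the stages need [B * n]; a node broadcasts at most [D.+1]
   times in the former and [B] times in the latter. *)
have [M [c Hc]] := falg_run (fixpoint_alg D k phi) (2 + B) (D.+1 + B).
exists M, c => N r deg.
have big e : (2 + B) * #|N| <= e -> 2 * #|N| <= e /\ B * #|N| <= e.
  by rewrite mulnDl => h; split; apply: leq_trans h; rewrite ?leq_addr ?leq_addl.
have [|R [e1 [e [[/big[b1 _] b2] Rres [R1 R2 R3 R4]]]]] := Hc N r deg.
  by move=> e1 u T /big[b1 _]; apply: payload_count.
exists R; split=> // a; apply: (final_stores deg b1 _ (Rres a)).
by apply: leq_trans b2; rewrite leq_add2l mulnDl mulnC leq_addl.
Qed.
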